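(* Assume that for some $\widetilde\theta\in\Theta$ with $R(\widetilde\theta)=\inf_\Theta R$, some real constant $c>0$ and some exponent $\kappa>1$, $$R(\theta)-R(\widetilde\theta)\ge c\,D(\theta,\widetilde\theta)^\kappa,\qquad\theta\in\Theta,$$ that $R:\Theta\to[0,1]$ is independent of $N$ (which is for instance the case when $\mathbb P=P^{\otimes N}$), and that $R$ is such that, for some positive real constant $d$, $$\lim_{\beta'\to+\infty}\beta'\bigl[\pi_{\exp(-\beta'R)}(R)-\inf_\Theta R\bigr]=d.$$ Then there are universal positive constants $B_7$ and $B_8$ and $N_1\in\mathbb N$ such that for any $N\ge N_1$, with $\mathbb P$ probability at least $1-\epsilon$, $$\pi_{\exp(-\widehat\gamma\frac r2)}(R)\le\inf_\Theta R+B_7\,c^{-\frac1{2\kappa-1}}\Bigl[1+\frac{B_8}{d}\log\Bigl(\frac{\log(N)}{\epsilon}\Bigr)\Bigr]^{\frac{2\kappa}{2\kappa-1}}\Bigl(\frac dN\Bigr)^{\frac{\kappa}{2\kappa-1}},$$ where $\widehat\gamma\in\arg\max_{\gamma\in\Lambda_2}\max\bigl\{\beta\in\Lambda_2: B(\pi_{\exp(-\gamma\frac r2)},\beta,\gamma)\le0\bigr\}$, with $\Lambda_2$ and $B$ defined in the context.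
   Context: Setting. $(\mathcal X,\mathcal B)$ is a measurable space, $\mathcal Y$ a finite set. $N$ is the sample size, $\Omega=(\mathcal X\times\mathcal Y)^N$ with coordinate process $(X_i,Y_i)_{i=1}^N$, and $\mathbb P=\bigotimes_{i=1}^NP_i$ is a product probability measure. $(\Theta,\mathcal T)$ is a measurable space, $\{f_\theta:\mathcal X\to\mathcal Y;\theta\in\Theta\}$ is jointly measurable, $\pi$ is a prior (sample independent) probability distribution on $\Theta$. $R(\theta)=\frac1N\sum_{i=1}^N\mathbb P[f_\theta(X_i)\ne Y_i]$, $r(\theta)=\frac1N\sum_{i=1}^N\mathbf 1[f_\theta(X_i)\ne Y_i]$, $D(\theta,\theta')=\frac1N\sum_{i=1}^N\mathbb P[f_\theta(X_i)\ne f_{\theta'}(X_i)]$, $m'(\theta,\theta')=\frac1N\sum_{i=1}^N|\mathbf 1[f_\theta(X_i)\ne Y_i]-\mathbf 1[f_{\theta'}(X_i)\ne Y_i]|$. $\rho(h)=\int h\,d\rho$, $\rho(m')$ is the function $\theta\mapsto\int m'(\theta,\theta')\rho(d\theta')$, $\frac{d\pi_{\exp(h)}}{d\pi}=\frac{\exp(h)}{\pi[\exp(h)]}$, and $\mathcal K$ is the Kullback divergence. $\epsilon\in(0,1)$ sets the confidence level; it also enters the definition of $B$. $\Lambda_2=\{2^k:k\in\mathbb N,\ 0\le k<\log(N)/\log(2)\}$, and $\nu$ is the uniform probability measure on $\Lambda_2$. $F_{\gamma,\alpha}(x)=-N\log[1-\tanh(\frac\gamma N)x]-\alpha x$; for $\alpha<N\tanh(\frac\gamma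 N)$, $F^{-1}_{\gamma,\alpha}$ is the inverse of the increasing bijection $F_{\gamma,\alpha}:[0,\tanh(\gamma/N)^{-1})\to[0,\infty)$. For a posterior distribution $\rho$ (a probability measure on $\Theta$ depending measurably on the sample) and $\beta,\gamma>0$, $$\begin{aligned}B(\rho,\beta,\gamma)=\inf_{\lambda_1,\lambda_2}\Bigl\{&\mathcal K[\rho,\pi_{\exp(-\lambda_1 r)}]+(\gamma-\lambda_1)[\rho(r)-\pi_{\exp(-\lambda_2 r)}(r)]\\&+\log\bigl\{\pi_{\exp(-\lambda_1 r)}\bigl[\exp\{N\log[\cosh(\tfrac{\gamma}{N})]\rho(m')\}\bigr]\bigr\}-\log[\epsilon\nu(\beta)\nu(\gamma)]\\&+(\gamma-\lambda_1)\tfrac{\beta}{\lambda_2}F^{-1}_{\gamma,\frac{\beta\gamma}{\lambda_2}}\Bigl[\log\bigl\{\pi_{\exp(-\lambda_2 r)}\bigl[\exp\{N\log[\cosh(\tfrac{\gamma}{N})]\pi_{\exp(-\lambda_2 r)}(m')\}\bigr]\bigr\}-\log[\epsilon\nu(\beta)\nu(\gamma)]\Bigr]\Bigr\},\end{aligned}$$ the infimum being over $0\le\lambda_1\le\gamma$ and $\lambda_2>\frac{\beta\gamma}{N}\tanh(\frac\gamma N)^{-1}$, where $\nu(\beta)=\nu(\{\beta\})$. *)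

(* Defs.v *)
From HB Require Import structures.
From mathcomp Require Import all_boot all_order all_algebra.
From mathcomp Require Import finmap.
From mathcomp Require Import all_classical all_reals all_analysis.
From mathcomp Require Import measurable_realfun.

Set Implicit Arguments.
Unset Strict Implicit.
Unset Printing Implicit Defensive.

Import Order.TTheory GRing.Theory Num.Theory.
Import numFieldNormedType.Exports.

Local Open Scope classical_set_scope.
Local Open Scope ring_scope.

Section hyperbolic.
Context {R : realType}.
Implicit Types x : R.

Definition cosh x : R := (expR x + expR (- x)) / 2.
Definition sinh x : R := (expR x - expR (- x)) / 2.
Definition tanh x : R := sinh x / cosh x.

End hyperbolic.

(* The Gibbs measure pi_{exp(h)} is made total in [h : T -> R], so that it is
   always a probability measure: a non-measurable [h] is read as 0, and
   [mnormalize] returns [pi] itself when pi[exp(h)] is infinite.  Neither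
   default is reached when [h] is bounded and measurable. *)
Section gibbs.
Context d (T : measurableType d) (R : realType).
Variables (pi : probability T R) (h : T -> R).

Definition exp_weight : T -> R :=
  if `[< measurable_fun setT h >] then expR \o h else cst 1.

Definition exp_measure (A : set T) : \bar R :=
  (\int[pi]_(x in A) (exp_weight x)%:E)%E.

Lemma exp_weight_ge0 x : 0 <= exp_weight x.
Proof.
by rewrite /exp_weight; case: ifPn => _ //=; exact: expR_ge0.
Qed.

Lemma measurable_exp_weight : measurable_fun setT exp_weight.
Proof.
rewrite /exp_weight; case: ifPn => [/asboolP mh|_].
- exact: measurableT_comp.
- exact: measurable_cst.
Qed.

Let exp_measure0 : exp_measure set0 = 0%E.
Proof. by rewrite /exp_measure integral_set0. Qed.

Let exp_measure_ge0 A : (0 <= exp_measure A)%E.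
Proof.
by apply: integral_ge0 => x _; rewrite lee_fin exp_weight_ge0.
Qed.

Let exp_measure_sigma_additive : semi_sigma_additive exp_measure.
Proof.
move=> F mF tF mUF; rewrite /exp_measure ge0_integral_bigcup//.
- apply: is_cvg_ereal_nneg_natsum_cond => n _ _.
  by apply: integral_ge0 => x _; rewrite lee_fin exp_weight_ge0.
- apply: (measurable_funS measurableT) => //.
  exact/measurable_EFinP/measurable_exp_weight.
- by move=> x _; rewrite lee_fin exp_weight_ge0.
Qed.

HB.instance Definition _ := isMeasure.Build _ _ _ exp_measure
  exp_measure0 exp_measure_ge0 exp_measure_sigma_additive.

Definition gibbs : probability T R := mnormalize exp_measure pi.

Lemma gibbsE (A : set T) : measurable_fun setT h ->
  (\int[pi]_x (expR (h x))%:E < +oo)%E ->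
  gibbs A = ((\int[pi]_(x in A) (expR (h x))%:E) *
             ((\int[pi]_x expR (h x))^-1)%:E)%E.
Proof.
move=> mh hfin.
have wE : exp_weight = expR \o h by rewrite /exp_weight asboolT.
have EE B : exp_measure B = (\int[pi]_(x in B) (expR (h x))%:E)%E.
  by rewrite /exp_measure wE.
have mE : measurable_fun setT (fun x => (expR (h x))%:E).
  apply/measurable_EFinP.
  exact: (measurableT_comp (@measurable_expR R)).
have E0 : (\int[pi]_x (expR (h x))%:E != 0)%E.
  apply/eqP => I0.
  have /(ae_eq_integral_abs pi measurableT mE) :
      (\int[pi]_x `|(expR (h x))%:E| = 0)%E.
    rewrite -[RHS]I0; apply: eq_integral => x _.
    by rewrite gee0_abs// lee_fin expR_ge0.
  case=> B [mB B0 BT].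
  have : pi setT = 0%E.
    apply/eqP; rewrite eq_le measure_ge0 andbT -B0.
    apply: le_measure; rewrite ?inE// => x _; apply: BT => /= /(_ I) [].
    by move/eqP; rewrite expR_eq0.
  by rewrite probability_setT => /eqP; rewrite onee_eq0.
have -> : gibbs A =
    (if (exp_measure setT == 0) || (exp_measure setT == +oo) then pi A
     else exp_measure A * ((fine (exp_measure setT))^-1)%:E)%E.
  by rewrite /gibbs /= /mnormalize /=; case: ifP.
by rewrite !EE (negbTE E0)/= lt_eqF.
Qed.

End gibbs.

Section kullback.
Context d (T : measurableType d) (R : realType).

Definition kullback (rho mu : probability T R) : \bar R :=
  if `[< rho `<< mu >]
  then (\int[rho]_x
          (ln (fine (Radon_Nikodym (charge_of_finite_measure rho) mu x)))%:E)%E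
  else +oo%E.

End kullback.

Definition is_product_measure d (Z : measurableType d) (R : realType) (N : nat)
    (PP : probability (N.-tuple Z) R) (P : 'I_N -> probability Z R) : Prop :=
  forall A : 'I_N -> set Z, (forall i, measurable (A i)) ->
    PP [set w | forall i, A i (tnth w i)] = (\prod_(i < N) P i (A i))%E.

Section risks.
Context dX (X : measurableType dX) dY (Y : measurableType dY).
Context (R : realType) (Theta : Type) (f : Theta -> X -> Y).
Variable N : nat.
Implicit Types (PP : probability (N.-tuple (X * Y)) R) (w : N.-tuple (X * Y)).
Implicit Types t : Theta.

Definition risk PP t : R :=
  N%:R^-1 * \sum_(i < N)
    fine (PP [set w | f t (tnth w i).1 != (tnth w i).2]).

Definition disagreement PP t t' : R :=
  N%:R^-1 * \sum_(i < N)
    fine (PP [set w | f t (tnth w i).1 != f t' (tnth w i).1]).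

Definition emp_risk w t : R :=
  N%:R^-1 * \sum_(i < N) (f t (tnth w i).1 != (tnth w i).2)%:R.

Definition emp_dist w t t' : R :=
  N%:R^-1 * \sum_(i < N)
    `| (f t (tnth w i).1 != (tnth w i).2)%:R
       - (f t' (tnth w i).1 != (tnth w i).2)%:R |.

End risks.
Arguments emp_risk {dX X dY Y} R {Theta} f {N} w t.
Arguments emp_dist {dX X dY Y} R {Theta} f {N} w t t'.

Section grid.
Context (R : realType) (N : nat).

Definition Lambda2 : set R :=
  [set 2 ^+ k | k in [set k : nat | k%:R < ln N%:R / ln 2 :> R]].

(* point masses of the uniform probability measure on [Lambda2] *)
Definition nu2 (b : R) : R := \1_Lambda2 b / #|` fset_set Lambda2|%:R.

Definition Ffun (gamma alpha x : R) : R :=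
  - (N%:R * ln (1 - tanh (gamma / N%:R) * x)) - alpha * x.

(* for alpha < N tanh(gamma/N), [Ffun gamma alpha] is an increasing bijection
   from [0, 1/tanh(gamma/N)) onto [0, +oo) and [Finv gamma alpha] inverts it *)
Definition Finv (gamma alpha : R) : R -> R :=
  'pinv_(fun=> 0) `[0, (tanh (gamma / N%:R))^-1[%classic (Ffun gamma alpha).

End grid.

Section bound.
Context dX (X : measurableType dX) dY (Y : measurableType dY).
Context dT (Theta : measurableType dT) (R : realType).
Variables (f : Theta -> X -> Y) (pi : probability Theta R) (eps : R).
Variables (N : nat) (w : N.-tuple (X * Y)).

Local Notation r := (emp_risk R f w).
Local Notation m' := (emp_dist R f w).

Definition emp_gibbs (lambda : R) : probability Theta R :=
  gibbs pi (fun t => - (lambda * r t)).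

(* log mu[exp(N log(cosh(gamma/N)) rho(m'))] *)
Definition log_moment (mu rho : probability Theta R) (gamma : R) : R :=
  ln (\int[mu]_t
        expR (N%:R * ln (cosh (gamma / N%:R)) * (\int[rho]_t' m' t t'))).

Definition log_level (beta gamma : R) : R :=
  ln (eps * nu2 N beta * nu2 N gamma).

Definition Bobj (rho : probability Theta R) (beta gamma l1 l2 : R) : \bar R :=
  (kullback rho (emp_gibbs l1) +
   ((gamma - l1) * ((\int[rho]_t r t) - (\int[emp_gibbs l2]_t r t))
    + log_moment (emp_gibbs l1) rho gamma
    - log_level beta gamma
    + (gamma - l1) * (beta / l2) *
      Finv N gamma (beta * gamma / l2)
        (log_moment (emp_gibbs l2) (emp_gibbs l2) gamma
         - log_level beta gamma))%:E)%E.

Definition Bfun (rho : probability Theta R) (beta gamma : R) : \bar R :=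
  ereal_inf [set Bobj rho beta gamma l.1 l.2 | l in
    [set l : R * R | 0 <= l.1 <= gamma /\
                     beta * gamma / N%:R * (tanh (gamma / N%:R))^-1 < l.2]].

(* max {beta in Lambda2 : B(pi_{exp(-gamma r/2)}, beta, gamma) <= 0}, with
   value -oo when there is no such beta ([Lambda2] is finite, so that the
   supremum of a nonempty subset is its maximum) *)
Definition beta_max (gamma : R) : \bar R :=
  ereal_sup [set beta%:E | beta in
    [set beta | Lambda2 N beta /\
      (Bfun (gibbs pi (fun t => - (gamma * (r t / 2)))%R) beta gamma <= 0)%E]].

Definition is_gamma_hat (gamma : R) : Prop :=
  Lambda2 N gamma /\
  forall gamma', Lambda2 N gamma' -> (beta_max gamma' <= beta_max gamma)%E.

End bound.

(* Main.v *)
(** Write [mu_b] for the Gibbs measure [pi_exp(-b R)], [K] for the cardinal of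
    [Lambda2] and [L] for [log (log N / eps)].

    For a difference [x] in [{-1, 0, 1}] of two errors, [exp (- a x - log (cosh a) |x|)]
    equals [1 - tanh a * x].  Hence, integrating the pairs [(theta, theta')] against
    [mu_b (x) mu_b], the exponential of
    [- N log (1 - tanh (g / N) (R - R')) - g (r - r') - N log (cosh (g / N)) m']
    has expectation at most 1.  When it is not too large, the Gibbs variational
    inequality turns it into [F_(g, b) (rho (R) - mu_b (R)) <= B (rho, b, g)], so that
    [B (rho, b, g) <= 0] implies [rho (R) <= mu_b (R) <= inf R + 2 d / b].

    It remains to see that some [b] in the grid of the order of the inverse of the rate
    satisfies [B <= 0] for some [g].  Take [lambda_1 = g / 2] and [lambda_2 = 4 b].  Up to
    bounded errors, the empirical partition functions can be replaced by those of [R]: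
    the deviations are of second order, hence controlled by the disagreement with the
    minimizer, which the margin assumption absorbs.  The growth of [mu_b (R)] gives
    [log] of the partition function a logarithmic slope [d] in [b], so the negative
    term of [B] is of order [g / b] and it wins as soon as [g / b >> L].  With [g] of
    order [N^u L^-a] and [g / b] of order [L^(1 + eta)], where [u = kappa / (2 kappa - 1)]
    and [a + 1 + 2 eta = 2 u], the remainders are harmless and [1 / b] is of order
    [N^-u L^(2 u - eta)]; the spare factor [L^eta] absorbs every constant, which is why
    [B_7 = B_8 = 1] will do.

    Since [B <= 0] forces [b < g], only [K (K - 1) / 2] pairs enter the union bound.
    This leaves half of [eps] for the six events on partition functions. *)

Require Import Defs.
From mathcomp Require Import all_boot all_order all_algebra.
From mathcomp Require Import all_classical all_reals all_analysis.
From mathcomp Require Import measurable_realfun ring lra.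

Set Implicit Arguments.
Unset Strict Implicit.
Unset Printing Implicit Defensive.

Import Order.TTheory GRing.Theory Num.Theory.
Import numFieldNormedType.Exports.

Local Open Scope classical_set_scope.
Local Open Scope ring_scope.

(** * Bounded measurable functions and Gibbs measures *)

Section bounded_measurable.
Context d (T : measurableType d) (R : realType).
Implicit Types (h g : T -> R).

(** Bounded measurable functions are stable under sums, products, [expR] and partial integration,
    and they are integrable for every probability, so linearity, Jensen and Fubini need no further
    integrability check. *)
Definition bmf h := measurable_fun [set: T] h /\ exists M : R, forall x, `|h x| <= M.

Lemma bmf_cst (a : R) : bmf (fun=> a).
Proof. by split; [exact: measurable_cst|exists `|a|]. Qed.

Lemma bmfD h g : bmf h -> bmf g -> bmf (fun x => h x + g x).
Proof.
move=> [mh [M hM]] [mg [M' gM]]; split; first exact: measurable_funD.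
by exists (M + M') => x; rewrite (le_trans (ler_normD _ _))// lerD.
Qed.

Lemma bmfM h g : bmf h -> bmf g -> bmf (fun x => h x * g x).
Proof.
move=> [mh [M hM]] [mg [M' gM]]; split; first exact: measurable_funM.
by exists (M * M') => x; rewrite normrM ler_pM.
Qed.

Lemma bmfZ (a : R) h : bmf h -> bmf (fun x => a * h x).
Proof. exact/bmfM/bmf_cst. Qed.

Lemma bmfN h : bmf h -> bmf (fun x => - h x).
Proof.
by move=> bh; under [X in bmf X]funext do rewrite -mulN1r; exact: bmfZ.
Qed.

Lemma bmfB h g : bmf h -> bmf g -> bmf (fun x => h x - g x).
Proof. by move=> bh bg; apply/(bmfD bh)/bmfN. Qed.

Lemma bmf_expR h : bmf h -> bmf (fun x => expR (h x)).
Proof.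
move=> [mh [M hM]]; split; first exact: measurableT_comp.
by exists (expR M) => x; rewrite ger0_norm ?expR_ge0// ler_expR (le_trans (ler_norm _)).
Qed.

Lemma bmf_sum (I : Type) (s : seq I) (F : I -> T -> R) :
  (forall i, bmf (F i)) -> bmf (fun x => \sum_(i <- s) F i x).
Proof.
move=> bF; elim: s => [|i s IH].
  by under [X in bmf X]funext do rewrite big_nil; exact: bmf_cst.
by under [X in bmf X]funext do rewrite big_cons; exact: bmfD.
Qed.

End bounded_measurable.

Arguments bmf_cst {d T R} a.

(** * Integrals of bounded functions, Jensen and Fubini *)

Section expectation.
Context d (T : measurableType d) (R : realType) (Q : probability T R).
Implicit Types (h g : T -> R).

Lemma bmf_integrable h : bmf h -> Q.-integrable [set: T] (EFin \o h).
Proof.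
move=> [mh [M hM]].
apply: (le_integrable measurableT (g := EFin \o cst M)).
- exact/measurable_EFinP.
- by move=> x _; rewrite /= lee_fin (le_trans (hM x)) ?ler_norm.
- exact: finite_measure_integrable_cst.
Qed.

Lemma bmf_EFin h : bmf h -> (\int[Q]_x h x)%:E = (\int[Q]_x (h x)%:E)%E.
Proof.
move=> bh; rewrite fineK//; apply: integrable_fin_num => //.
exact: bmf_integrable.
Qed.

Lemma bmf_intD h g : bmf h -> bmf g ->
  \int[Q]_x (h x + g x) = \int[Q]_x h x + \int[Q]_x g x.
Proof. by move=> *; rewrite RintegralD//; exact: bmf_integrable. Qed.

Lemma bmf_intB h g : bmf h -> bmf g ->
  \int[Q]_x (h x - g x) = \int[Q]_x h x - \int[Q]_x g x.
Proof. by move=> *; rewrite RintegralB//; exact: bmf_integrable. Qed.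

Lemma bmf_intZ (a : R) h : bmf h -> \int[Q]_x (a * h x) = a * \int[Q]_x h x.
Proof. by move=> *; rewrite RintegralZl//; exact: bmf_integrable. Qed.

Lemma bmf_intN h : bmf h -> \int[Q]_x (- h x) = - \int[Q]_x h x.
Proof.
move=> bh; rewrite -[RHS]mulN1r -bmf_intZ//.
by apply: eq_Rintegral => x _; rewrite mulN1r.
Qed.

Lemma prob_int_cst (a : R) : \int[Q]_x a = a.
Proof.
have Q1 : fine (Q [set: T]) = 1 by rewrite probability_setT.
by rewrite Rintegral_cst// -[RHS]mulr1 -Q1.
Qed.

Lemma bmf_le_int h g : bmf h -> bmf g -> (forall x, h x <= g x) ->
  \int[Q]_x h x <= \int[Q]_x g x.
Proof. by move=> *; apply: le_Rintegral => //; exact: bmf_integrable. Qed.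

Lemma bmf_le_int_cst h (a : R) : bmf h -> (forall x, h x <= a) ->
  \int[Q]_x h x <= a.
Proof.
move=> bh ha; rewrite -[leRHS]prob_int_cst.
by apply: bmf_le_int => //; exact: bmf_cst.
Qed.

Lemma bmf_cst_le_int h (a : R) : bmf h -> (forall x, a <= h x) ->
  a <= \int[Q]_x h x.
Proof.
move=> bh ha; rewrite -[leLHS]prob_int_cst.
by apply: bmf_le_int => //; exact: bmf_cst.
Qed.

Lemma bmf_int_sum (I : Type) (s : seq I) (F : I -> T -> R) :
  (forall i, bmf (F i)) ->
  \int[Q]_x (\sum_(i <- s) F i x) = \sum_(i <- s) \int[Q]_x F i x.
Proof.
move=> bF; elim: s => [|i s IH].
  under eq_Rintegral do rewrite big_nil.
  by rewrite prob_int_cst big_nil.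
under eq_Rintegral do rewrite big_cons.
by rewrite bmf_intD ?IH ?big_cons//; exact: bmf_sum.
Qed.

Lemma bmf_int_affine (c0 c1 c2 c3 : R) h1 h2 h3 :
  bmf h1 -> bmf h2 -> bmf h3 ->
  \int[Q]_x (c0 + c1 * h1 x + c2 * h2 x + c3 * h3 x) =
  c0 + c1 * \int[Q]_x h1 x + c2 * \int[Q]_x h2 x + c3 * \int[Q]_x h3 x.
Proof.
move=> b1 b2 b3; have b01 := bmfD (bmf_cst c0) (bmfZ c1 b1).
have b012 := bmfD b01 (bmfZ c2 b2).
rewrite (bmf_intD b012 (bmfZ c3 b3)) (bmf_intD b01 (bmfZ c2 b2)).
rewrite (bmf_intD (bmf_cst c0) (bmfZ c1 b1)) prob_int_cst.
by rewrite (bmf_intZ c1 b1) (bmf_intZ c2 b2) (bmf_intZ c3 b3).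
Qed.

Lemma expR_tangent (a b : R) : expR a * (1 + (b - a)) <= expR b.
Proof.
have -> : expR b = expR a * expR (b - a) by rewrite -expRD addrC subrK.
by rewrite ler_pM2l ?expR_gt0// expR_ge1Dx.
Qed.

(** The tangent of [expR] at the mean lies below [expR], and its integral is its value at the
    mean. *)
Lemma jensen_expR h : bmf h -> expR (\int[Q]_x h x) <= \int[Q]_x expR (h x).
Proof.
move=> bh; set a := \int[Q]_x h x.
have bt : bmf (fun x => expR a * (1 + (h x - a))).
  by apply: bmfZ; apply: bmfD; [exact: bmf_cst|apply: bmfB => //; exact: bmf_cst].
apply: (@le_trans _ _ (\int[Q]_x (expR a * (1 + (h x - a))))).
  rewrite bmf_intZ ?bmf_intD ?bmf_intB ?prob_int_cst ?subrr ?addr0 ?mulr1//;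
    do ?[exact: bmf_cst|exact: bmfB bh (bmf_cst _)
        |exact: bmfD (bmf_cst _) (bmfB bh (bmf_cst _))].
by apply: bmf_le_int => //; [exact: bmf_expR|move=> x; exact: expR_tangent].
Qed.

Lemma int_expR_gt0 h : bmf h -> 0 < \int[Q]_x expR (h x).
Proof. by move=> bh; apply: lt_le_trans (jensen_expR bh); exact: expR_gt0. Qed.

Lemma jensen_ln h : bmf h -> \int[Q]_x h x <= ln (\int[Q]_x expR (h x)).
Proof.
by move=> bh; rewrite -[leLHS]expRK ler_ln ?posrE ?expR_gt0 ?int_expR_gt0 ?jensen_expR.
Qed.

End expectation.

Section composition.
Context d1 (T1 : measurableType d1) d2 (T2 : measurableType d2) (R : realType).

Lemma bmf_comp (g : T1 -> T2) (h : T2 -> R) : measurable_fun [set: T1] g ->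
  bmf h -> bmf (fun x => h (g x)).
Proof.
move=> mg [mh [M hM]]; split; first exact: (measurableT_comp mh).
by exists M => x.
Qed.

End composition.

Section fubini_bounded.
Context d1 (T1 : measurableType d1) d2 (T2 : measurableType d2) (R : realType).
Variables (Q1 : probability T1 R) (Q2 : probability T2 R).
Implicit Type F : T1 * T2 -> R.

Lemma bmf_pair1 F x : bmf F -> bmf (fun y => F (x, y)).
Proof. exact: bmf_comp. Qed.

Lemma bmf_pair2 F y : bmf F -> bmf (fun x => F (x, y)).
Proof. exact: bmf_comp. Qed.

(** Measurability is part of Fubini's theorem for [Q1 \x Q2]; the bound on [F] passes to its partial
    integrals. *)
Lemma bmf_int2 F : bmf F -> bmf (fun x => \int[Q2]_y F (x, y)).
Proof.
move=> bF; split; last first.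
  have [_ [M FM]] := bF; exists M => x.
  rewrite ler_norml bmf_cst_le_int ?bmf_le_int_cst//; do ?exact: bmf_pair1.
  - by move=> y; rewrite (le_trans (ler_norm _)).
  - by move=> y; rewrite lerNl (le_trans _ (FM (x, y)))// -normrN ler_norm.
apply/measurable_EFinP.
have := measurable_fubini_F (bmf_integrable (Q1 \x Q2)%E bF).
congr measurable_fun; apply/funext => x.
by rewrite /= /fubini_F/= bmf_EFin//; exact: bmf_pair1.
Qed.

Lemma bmf_int1 F : bmf F -> bmf (fun y => \int[Q1]_x F (x, y)).
Proof.
move=> bF; split; last first.
  have [_ [M FM]] := bF; exists M => y.
  rewrite ler_norml bmf_cst_le_int ?bmf_le_int_cst//; do ?exact: bmf_pair2.
  - by move=> x; rewrite (le_trans (ler_norm _)).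
  - by move=> x; rewrite lerNl (le_trans _ (FM (x, y)))// -normrN ler_norm.
apply/measurable_EFinP.
have := measurable_fubini_G (bmf_integrable (Q1 \x Q2)%E bF).
congr measurable_fun; apply/funext => y.
by rewrite /= /fubini_G/= bmf_EFin//; exact: bmf_pair2.
Qed.

Lemma bmf_fubini F : bmf F ->
  \int[Q1]_x \int[Q2]_y F (x, y) = \int[Q2]_y \int[Q1]_x F (x, y).
Proof.
move=> bF; apply: EFin_inj; rewrite !bmf_EFin; do ?[exact: bmf_int1|exact: bmf_int2].
under eq_integral => x _ do rewrite (bmf_EFin Q2 (bmf_pair1 x bF)).
under [RHS]eq_integral => y _ do rewrite (bmf_EFin Q1 (bmf_pair2 y bF)).
exact: (Fubini (bmf_integrable (Q1 \x Q2)%E bF)).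
Qed.

End fubini_bounded.

(** * Measures with an explicit density *)

Section change_of_density.
Context d (T : measurableType d) (R : realType) (Q Q' : probability T R).
Variable w : T -> R.
Hypothesis bw : bmf w.
Hypothesis Q'E : forall A, measurable A -> Q' A = (\int[Q]_(x in A) (w x)%:E)%E.

Lemma density_dominates : Q' `<< Q.
Proof.
apply/null_content_dominatesP => A mA QA0; rewrite Q'E//.
have wA : measurable_fun A (EFin \o w).
  by apply: measurable_funTS; apply/measurable_EFinP; exact: bw.1.
exact: null_set_integral.
Qed.

(** Both functions integrate to [Q'] over every measurable set, which determines them almost
    everywhere. *)
Lemma density_RN : ae_eq Q [set: T]
  (Radon_Nikodym (charge_of_finite_measure Q') Q) (EFin \o w).
Proof.
have dom := density_dominates.
apply: integral_ae_eq => //.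
- exact: Radon_Nikodym_integrable.
- by apply/measurable_EFinP; exact: bw.1.
- by move=> A _ mA; rewrite -Radon_Nikodym_integral//= Q'E.
Qed.

Lemma density_int g : bmf g -> \int[Q']_x g x = \int[Q]_x (g x * w x).
Proof.
move=> bg; apply: EFin_inj; rewrite !bmf_EFin//; last exact: bmfM.
have dom := density_dominates.
rewrite -(Radon_Nikodym_change_of_variables dom measurableT); last exact: bmf_integrable.
apply: ae_eq_integral => //.
- apply: emeasurable_funM; first by apply/measurable_EFinP; exact: bg.1.
  by apply: measurable_int; exact: Radon_Nikodym_integrable.
- by apply/measurable_EFinP; exact: (bmfM bg bw).1.
- have := density_RN; apply: filterS => x /= wx Dx.
  by rewrite wx.
Qed.

End change_of_density.

Section indicator.
Context d (T : measurableType d) (R : realType) (Q : probability T R).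

Lemma bmf_indic (A : set T) : measurable A -> bmf (\1_A : T -> R).
Proof.
move=> mA; split; first exact: measurable_indic.
by exists 1 => x; rewrite indicE; case: (_ \in _); rewrite ?normr1 ?normr0.
Qed.

Lemma bmf_int_indic (A : set T) : measurable A ->
  \int[Q]_x (\1_A x : R) = fine (Q A).
Proof. by move=> mA; rewrite /Rintegral integral_indic// setIT. Qed.

Lemma bmf_int_restrict h A : bmf h -> measurable A ->
  (\int[Q]_(x in A) (h x)%:E)%E = (\int[Q]_x (\1_A x * h x))%:E.
Proof.
move=> bh mA; rewrite bmf_EFin; last by apply: bmfM => //; exact: bmf_indic.
rewrite integral_mkcond; apply: eq_integral => x _.
by rewrite patchE indicE; case: (x \in A); rewrite ?mul1r ?mul0r.
Qed.

End indicator.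

(** * Gibbs measures and convexity of the log partition function *)

Section gibbs_integral.
Context d (T : measurableType d) (R : realType) (Q : probability T R).
Implicit Types g h : T -> R.

Definition partition h : R := \int[Q]_x expR (h x).

Lemma partition_gt0 h : bmf h -> 0 < partition h.
Proof. exact: int_expR_gt0. Qed.

Lemma bmf_gibbs_density h : bmf h -> bmf (fun x => expR (h x) / partition h).
Proof. by move=> bh; apply: bmfM; [exact: bmf_expR|exact: bmf_cst]. Qed.

Lemma gibbs_density h A : bmf h -> measurable A ->
  gibbs Q h A = (\int[Q]_(x in A) (expR (h x) / partition h)%:E)%E.
Proof.
move=> bh mA; rewrite gibbsE; first last.
- by rewrite -bmf_EFin ?ltry//; exact: bmf_expR.
- exact: bh.1.
under [RHS]eq_integral do rewrite EFinM muleC.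
rewrite integralZl//; last first.
  by apply: (integrableS measurableT) => //; exact/bmf_integrable/bmf_expR.
by rewrite muleC.
Qed.

Lemma gibbs_int h g : bmf h -> bmf g ->
  \int[gibbs Q h]_x g x = (\int[Q]_x (g x * expR (h x))) / partition h.
Proof.
move=> bh bg.
have dens A (mA : measurable A) := gibbs_density bh mA.
rewrite (density_int (bmf_gibbs_density bh) dens)// mulrC -bmf_intZ; last first.
  by apply: bmfM => //; exact: bmf_expR.
by apply: eq_Rintegral => x _; ring.
Qed.

Lemma gibbs_int_expR h g : bmf h -> bmf g ->
  \int[gibbs Q h]_x expR (g x) = partition (fun x => h x + g x) / partition h.
Proof.
move=> bh bg; rewrite gibbs_int//; last exact: bmf_expR.
by congr (_ / _); apply: eq_Rintegral => x _; rewrite expRD mulrC.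
Qed.

(* Gibbs variational inequality: the tangent of the convex functional
   [h |-> ln (partition h)] at [h] lies below it. *)
Lemma ln_partition_ge h g : bmf h -> bmf g ->
  ln (partition h) + \int[gibbs Q h]_x (g x - h x) <= ln (partition g).
Proof.
move=> bh bg; have bgh := bmfB bg bh.
have := jensen_ln (gibbs Q h) bgh; rewrite gibbs_int_expR//.
rewrite (_ : (fun x => h x + (g x - h x)) = g); last first.
  by apply/funext => x; rewrite addrC subrK.
by rewrite lnM ?posrE ?invr_gt0 ?partition_gt0// lnV ?posrE ?partition_gt0// lerBrDl.
Qed.

Lemma ln_partition_shift h (c : R) : bmf h ->
  ln (partition (fun x => h x + c)) = ln (partition h) + c.
Proof.
move=> bh; have -> : partition (fun x => h x + c) = expR c * partition h.
  rewrite /partition -bmf_intZ; last exact: bmf_expR.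
  by apply: eq_Rintegral => x _; rewrite expRD mulrC.
by rewrite lnM ?posrE ?expR_gt0 ?partition_gt0// expRK addrC.
Qed.

(** Case of [ln_partition_ge] along the multiples of [q]: minus the centered Gibbs mean of [q] at
    [a] is the slope of the tangent there. *)
Lemma ln_partition_gap (q : T -> R) (c a b : R) : bmf q ->
  ln (partition (fun x => - (a * (q x - c))))
    - ln (partition (fun x => - (b * (q x - c))))
  <= (b - a) * (\int[gibbs Q (fun x => - (a * q x))]_x q x - c).
Proof.
move=> bq.
have aux (la lb u : R) : la + (a - b) * u <= lb ->
  la + a * c - (lb + b * c) <= (b - a) * (u - c) by move=> *; lra.
have bG y : bmf (fun x => - (y * q x)) by apply: bmfN; exact: bmfZ.
have shift y : ln (partition (fun x => - (y * (q x - c)))) =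
    ln (partition (fun x => - (y * q x))) + y * c.
  rewrite -(ln_partition_shift _ (bG y)); congr ln; apply: eq_Rintegral => x _.
  by congr expR; ring.
rewrite (shift a) (shift b); have P1 := ln_partition_ge (bG a) (bG b).
apply: aux; rewrite -(bmf_intZ _ _ bq); congr (_ + _ <= _): P1.
by apply: eq_Rintegral => x _; ring.
Qed.

Section dyadic_growth.
Variables (q : T -> R) (c del x0 : R).
Hypotheses (bq : bmf q) (x00 : 0 < x0).
Hypothesis growth : forall x, x0 <= x ->
  del / 2 <= x * (\int[gibbs Q (fun y => - (x * q y))]_y q y - c) <= 2 * del.

Local Notation phi x := (ln (partition (fun y => - (x * (q y - c))))).

(** By [ln_partition_gap] in both directions, one doubling of [x] lowers [phi] by at most [x] times
    the excess mean at [x], and by at least [x] times the one at [2 * x]. Under [growth] this lies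
    between [del / 4] and [2 * del]. *)
Lemma dyadic_growth (n : nat) (x : R) : x0 <= x ->
  n%:R * (del / 4) <= phi x - phi (2 ^+ n * x) <= n%:R * (2 * del).
Proof.
have aux (m y p p1 p2 u v : R) : p - p1 <= (2 * y - y) * u ->
    p1 - p <= (y - 2 * y) * v ->
    del / 2 <= y * u <= 2 * del -> del / 2 <= 2 * y * v <= 2 * del ->
    m * (del / 4) <= p1 - p2 <= m * (2 * del) ->
    (1 + m) * (del / 4) <= p - p2 <= (1 + m) * (2 * del).
  by move=> h1 h2 /andP[h3 h4] /andP[h5 h6] /andP[h7 h8]; apply/andP; split; lra.
elim: n x => [|n IH] x xx0; first by rewrite expr0 mul1r subrr !mul0r lexx.
have x2 : x0 <= 2 * x.
  by rewrite (le_trans xx0)// ler_peMl ?ler1n// (le_trans (ltW x00)).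
rewrite exprSr -mulrA -natr1 [_%:R + 1]addrC.
exact: (aux _ _ _ _ _ _ _ (ln_partition_gap c x (2 * x) bq)
  (ln_partition_gap c (2 * x) x bq) (growth xx0) (growth x2) (IH _ x2)).
Qed.

End dyadic_growth.

Lemma gibbs_gibbs_density h1 h2 A : bmf h1 -> bmf h2 -> measurable A ->
  gibbs Q h1 A = (\int[gibbs Q h2]_(x in A)
    (expR (h1 x - h2 x) * (partition h2 / partition h1))%:E)%E.
Proof.
move=> bh1 bh2 mA; set w := fun x => expR (h1 x - h2 x) * (partition h2 / partition h1).
have bw : bmf w by apply: bmfM; [exact/bmf_expR/bmfB|exact: bmf_cst].
rewrite gibbs_density// !bmf_int_restrict//; last exact: bmf_gibbs_density.
have bA := bmf_indic R mA.
rewrite gibbs_int//; last exact: bmfM.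
have Z20 : partition h2 != 0 by rewrite gt_eqF ?partition_gt0.
have Z10 : partition h1 != 0 by rewrite gt_eqF ?partition_gt0.
rewrite mulrC -bmf_intZ; last by apply: bmfM; [exact: bmfM|exact: bmf_expR].
congr EFin; apply: eq_Rintegral => x _.
have -> : expR (h1 x) = expR (h1 x - h2 x) * expR (h2 x) by rewrite -expRD subrK.
rewrite /w.
move: (expR _) (expR _) (partition _) (partition _) (\1_A _) Z20 Z10.
by move=> a b z2 z1 i z20 z10; field; rewrite z10.
Qed.

(** The density of one Gibbs measure with respect to the other is [expR (h1 x - h2 x)] times a ratio
    of partition functions; integrate its logarithm. *)
Lemma kullback_gibbs h1 h2 : bmf h1 -> bmf h2 ->
  kullback (gibbs Q h1) (gibbs Q h2) =
  (\int[gibbs Q h1]_x (h1 x - h2 x) - ln (partition h1) + ln (partition h2))%:E.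
Proof.
move=> bh1 bh2.
have bw : bmf (fun x => expR (h1 x - h2 x) * (partition h2 / partition h1)).
  by apply: bmfM; [exact/bmf_expR/bmfB|exact: bmf_cst].
have dens A (mA : measurable A) := gibbs_gibbs_density bh1 bh2 mA.
have dom := density_dominates bw dens.
rewrite /kullback asboolT//.
have b12 := bmfB bh1 bh2.
have -> : \int[gibbs Q h1]_x (h1 x - h2 x) - ln (partition h1) + ln (partition h2)
  = \int[gibbs Q h1]_x (h1 x - h2 x + (ln (partition h2) - ln (partition h1))).
  by rewrite (bmf_intD _ b12 (bmf_cst _)) prob_int_cst -addrA [- _ + _]addrC.
rewrite bmf_EFin; last exact: bmfD b12 (bmf_cst _).
apply: ae_eq_integral => //.
- apply/measurable_EFinP; apply: measurableT_comp; first exact: measurable_ln.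
  apply: (measurableT_comp (fine_measurable measurableT)).
  by apply: measurable_int; exact: Radon_Nikodym_integrable.
- by apply/measurable_EFinP; exact: (bmfD b12 (bmf_cst _)).1.
- have := null_dominates_ae_eq measurableT dom (density_RN bw dens).
  apply: filterS => x /= wx Dx; rewrite wx//=.
  rewrite lnM ?posrE ?expR_gt0 ?divr_gt0 ?partition_gt0//.
  by rewrite expRK lnM ?posrE ?invr_gt0 ?partition_gt0// lnV ?posrE ?partition_gt0.
Qed.

Lemma kullback_gibbs_ge0 h1 h2 : bmf h1 -> bmf h2 ->
  (0 <= kullback (gibbs Q h1) (gibbs Q h2))%E.
Proof.
move=> bh1 bh2; rewrite kullback_gibbs// lee_fin.
have := ln_partition_ge bh1 bh2.
rewrite (bmf_intB _ bh1 bh2) (bmf_intB _ bh2 bh1).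
move: (\int[_]_x h1 x) (\int[_]_x h2 x) (ln (partition h1)) (ln (partition h2)).
by move=> a b c e; lra.
Qed.

End gibbs_integral.

(** * Markov's inequality and independence *)

Section markov.
Context d (W : measurableType d) (R : realType) (P : probability W R).

(** Markov's inequality at level 1, stated for the complementary event: the indicator of [1 < X w]
    is at most [X]. *)
Lemma bmf_markov (X : W -> R) (a : R) : bmf X -> (forall w, 0 <= X w) ->
  \int[P]_w X w <= a ->
  measurable [set w | X w <= 1] /\ ((1 - a)%:E <= P [set w | (X w <= 1)%R])%E.
Proof.
move=> bX X0 Xa.
have mA : measurable [set w | X w <= 1].
  have := bX.1 measurableT _ (measurable_itv `]-oo, 1]).
  by rewrite setTI; congr measurable; apply/seteqP; split => w /=; rewrite in_itv.
split=> //.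
have -> : [set w | X w <= 1] = ~` [set w | 1 < X w].
  by apply/seteqP; split => w /=; [move/le_gtF => ->|move/negP; rewrite -leNgt].
have mB : measurable [set w | 1 < X w].
  have := bX.1 measurableT _ (measurable_itv `]1, +oo[).
  by rewrite setTI; congr measurable; apply/seteqP; split => w /=; rewrite in_itv/= andbT.
rewrite probability_setC//.
have -> : P [set w | 1 < X w] = (fine (P [set w | 1 < X w]))%:E.
  by rewrite fineK// fin_num_measure.
rewrite -EFinB lee_fin lerB// -bmf_int_indic//; apply: le_trans Xa.
apply: bmf_le_int => //; first exact: bmf_indic.
move=> w; rewrite indicE; case: (boolP (w \in _)) => //; rewrite inE /=; exact: ltW.
Qed.

End markov.

Section product_moment.
Context d (Z : measurableType d) (R : realType) (N : nat).
Variables (PP : probability (N.-tuple Z) R) (P : 'I_N -> probability Z R).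
Hypothesis prodPP : is_product_measure PP P.

Lemma product_marginal (i : 'I_N) (A : set Z) : measurable A ->
  PP [set w | A (tnth w i)] = P i A.
Proof.
move=> mA; have := @prodPP (fun j => if j == i then A else setT).
have -> : [set w : N.-tuple Z | forall j, (if j == i then A else setT) (tnth w j)] =
    [set w | A (tnth w i)].
  apply/seteqP; split => w /=; first by move/(_ i); rewrite eqxx.
  by move=> Aw j; case: eqP => // ->.
move=> ->; last by move=> j; case: ifP.
rewrite (bigD1 i)//= eqxx big1 ?mule1// => j /negbTE ->.
exact: probability_setT.
Qed.

Lemma measurable_tuple_cylinder (A : 'I_N -> set Z) : (forall i, measurable (A i)) ->
  measurable [set w : N.-tuple Z | forall i, A i (tnth w i)].
Proof.
move=> mA; rewrite [X in measurable X](_ : _ =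
    \bigcap_(i in [set: 'I_N]) [set w | A i (tnth w i)]); last first.
  by apply/seteqP; split => w /= Aw i; [move=> _|]; exact: Aw.
apply: fin_bigcap_measurable; first exact: finite_finset.
move=> i _; rewrite -[X in measurable X]setTI.
exact: (measurable_tnth i measurableT).
Qed.

End product_moment.

Section label_expectation.
Context d (Z : measurableType d) (R : realType) (Q : probability Z R).

Lemma label_expectation (K : finType) (lab : Z -> K) (G : K -> R) :
  (forall k, measurable [set z | lab z = k]) ->
  bmf (fun z => G (lab z)) /\
  \int[Q]_z G (lab z) = \sum_(k : K) G k * fine (Q [set z | lab z = k]).
Proof.
move=> mlab.
have -> : (fun z => G (lab z)) =
    (fun z => \sum_(k : K) G k * \1_[set z | lab z = k] z).
  apply/funext => z; rewrite (bigD1 (lab z))//= big1 ?addr0; last first.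
    move=> k nk; rewrite indicE memNset ?mulr0//=.
    by move=> lk; move/eqP: nk; apply.
  by rewrite indicE mem_set/= ?mulr1.
have bk k : bmf (fun z => G k * \1_[set z | lab z = k] z).
  by apply: bmfZ; exact: bmf_indic.
split; first exact: bmf_sum.
rewrite bmf_int_sum//; apply: eq_bigr => k _.
by rewrite bmf_intZ ?bmf_int_indic//; exact: bmf_indic.
Qed.

End label_expectation.

Section product_expectation.
Context d (Z : measurableType d) (R : realType) (N : nat).
Variables (PP : probability (N.-tuple Z) R) (P : 'I_N -> probability Z R).
Hypothesis prodPP : is_product_measure PP P.

(* Independence is only needed for functions of finitely valued labels, where
   it follows by expanding over all the values of the labels. *)
Lemma product_expectation (K : finType) (lab : 'I_N -> Z -> K) (G : K -> R) :
  (forall i k, measurable [set z | lab i z = k]) ->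
  \int[PP]_w \prod_(i < N) G (lab i (tnth w i)) =
  \prod_(i < N) \int[P i]_z G (lab i z).
Proof.
move=> mlab; under [RHS]eq_bigr => i _ do rewrite (label_expectation (P i) G (mlab i)).2.
have GE w : \prod_(i < N) G (lab i (tnth w i)) =
    \sum_(s : {ffun 'I_N -> K}) (\prod_(i < N) G (s i)) *
      \1_[set w : N.-tuple Z | forall i, lab i (tnth w i) = s i] w.
  rewrite (bigD1 [ffun i => lab i (tnth w i)])//= [X in _ + X]big1 ?addr0; last first.
    move=> s ns; rewrite indicE memNset ?mulr0//=.
    by move=> ls; move/eqP: ns; apply; apply/ffunP => i; rewrite ffunE.
  rewrite indicE mem_set/= ?mulr1; last by move=> i; rewrite ffunE.
  by apply: eq_bigr => i _; rewrite ffunE.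
under eq_Rintegral do rewrite GE.
have ms (s : {ffun 'I_N -> K}) : measurable
    [set w : N.-tuple Z | forall i, lab i (tnth w i) = s i].
  exact: (measurable_tuple_cylinder (A := fun i => [set z | lab i z = s i])).
rewrite bmf_int_sum; last by move=> s; apply: bmfZ; exact: bmf_indic.
rewrite bigA_distr_bigA; apply: eq_bigr => s _.
rewrite bmf_intZ ?bmf_int_indic//; last exact: bmf_indic.
rewrite (prodPP (A := fun i => [set z | lab i z = s i]))//.
rewrite big_split/=; congr (_ * _).
rewrite (eq_bigr (fun i => (fine (P i [set z | lab i z = s i]))%:E)); last first.
  by move=> i _; rewrite fineK// fin_num_measure.
by rewrite -(big_morph EFin EFinM erefl).
Qed.

End product_expectation.

(** * Hyperbolic functions, the grid and the rates *)

Section hyperbolic_bounds.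
Context {R : realType}.
Implicit Types a x : R.

(** Inverts [1 + y <= expR y], taken at [y = - x] when [x <= 0]. For [x > 0] that bound degenerates
    near 1, so it is taken at [y = - (x / 2)] and squared. *)
Lemma expR_le_quadratic x : `|x| <= 1 -> expR x <= 1 + x + 2 * x ^+ 2.
Proof.
rewrite ler_norml => /andP[x1 x2].
have [x0|x0] := leP x 0.
  have e1 := expR_ge1Dx (- x).
  have p1 : 0 < 1 - x by lra.
  have -> : expR x = (expR (- x))^-1 by rewrite expRN invrK.
  apply: (@le_trans _ _ (1 - x)^-1); first by rewrite lef_pV2// posrE expR_gt0.
  by rewrite -div1r ler_pdivrMr; nra.
have p1 : 0 < 1 - x / 2 by lra.
have -> : expR x = (expR (- (x / 2)))^-1 ^+ 2.
  by rewrite expRN invrK -expRM_natl; congr expR; field.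
apply: (@le_trans _ _ ((1 - x / 2)^-1 ^+ 2)).
  rewrite lerXn2r ?nnegrE ?invr_ge0 ?expR_ge0 ?(ltW p1)//.
  by rewrite lef_pV2 ?posrE ?expR_gt0// expR_ge1Dx.
rewrite exprVn -div1r ler_pdivrMr ?exprn_gt0//.
suff : 0 <= x ^+ 2 * ((1 - x) * (5 / 4 - x / 2)) by lra.
by apply: mulr_ge0; [exact: sqr_ge0|apply: mulr_ge0; lra].
Qed.

Lemma cosh_gt0 a : 0 < cosh a.
Proof. by rewrite /cosh divr_gt0// addr_gt0 ?expR_gt0. Qed.

Lemma cosh_ge1 a : 1 <= cosh a.
Proof.
have := expR_ge1Dx a; have := expR_ge1Dx (- a); rewrite /cosh; lra.
Qed.

Lemma ln_cosh_ge0 a : 0 <= ln (cosh a).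
Proof. by rewrite ln_ge0// cosh_ge1. Qed.

Lemma ln_cosh_le a : 0 <= a <= 1 -> ln (cosh a) <= 2 * a ^+ 2.
Proof.
move=> /andP[a0 a1].
have h1 : expR a <= 1 + a + 2 * a ^+ 2.
  by apply: expR_le_quadratic; rewrite ger0_norm.
have h2 : expR (- a) <= 1 - a + 2 * a ^+ 2.
  by have := @expR_le_quadratic (- a); rewrite normrN ger0_norm// sqrrN; exact.
have h3 : cosh a <= expR (2 * a ^+ 2).
  by have := expR_ge1Dx (2 * a ^+ 2); rewrite /cosh; lra.
by rewrite -[leRHS]expRK ler_ln ?posrE ?cosh_gt0 ?expR_gt0.
Qed.

Lemma tanhE a : tanh a = (expR a - expR (- a)) / (expR a + expR (- a)).
Proof.
rewrite /tanh /sinh /cosh.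
have : expR a + expR (- a) != 0 by rewrite gt_eqF// addr_gt0 ?expR_gt0.
by move=> h; field.
Qed.

(** With [expR_ln_cosh], the values at 1 and -1 of the identity that makes [pair_exponent] have
    exponential moment at most 1. *)
Lemma expRN_ln_cosh a : expR (- a - ln (cosh a)) = 1 - tanh a.
Proof.
rewrite expRD expRN expRN lnK ?posrE ?cosh_gt0// -expRN tanhE /cosh.
have : expR a + expR (- a) != 0 by rewrite gt_eqF// addr_gt0 ?expR_gt0.
by move=> h; field.
Qed.

Lemma expR_ln_cosh a : expR (a - ln (cosh a)) = 1 + tanh a.
Proof.
rewrite expRD [expR (- ln _)]expRN lnK ?posrE ?cosh_gt0// tanhE /cosh.
have : expR a + expR (- a) != 0 by rewrite gt_eqF// addr_gt0 ?expR_gt0.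
by move=> h; field.
Qed.

Lemma tanh_lt1 a : tanh a < 1.
Proof. by rewrite -subr_gt0 -expRN_ln_cosh expR_gt0. Qed.

Lemma tanh_expR2 a : tanh a = (expR (2 * a) - 1) / (expR (2 * a) + 1).
Proof.
have h : expR a = expR (2 * a) * expR (- a) by rewrite -expRD; congr expR; ring.
rewrite tanhE h; have e0 := expR_gt0 (- a); have e2 := expR_gt0 (2 * a).
move: (expR _) (expR _) e0 e2 => E e e0 E0.
have ne : E + 1 != 0 by rewrite gt_eqF//; lra.
have ne' : E * e + e != 0 by rewrite gt_eqF//; nra.
by field; rewrite ne ne'.
Qed.

Lemma tanh_ge a : 0 <= a <= 1 -> a / 2 <= tanh a.
Proof.
move=> /andP[a0 a1]; rewrite tanh_expR2.
have := expR_ge1Dx (2 * a); move: (expR _) => E E1.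
rewrite ler_pdivlMr; last by lra.
have : (1 + 2 * a) * (1 - a / 2) <= E * (1 - a / 2) by apply: ler_wpM2r; lra.
by nra.
Qed.

Lemma tanh_le a : 0 <= a -> tanh a <= 2 * a.
Proof.
move=> a0; rewrite tanh_expR2.
have e3 := expR_ge1Dx (- (2 * a)).
have e4 : expR (2 * a) * expR (- (2 * a)) = 1 by rewrite -expRD subrr expR0.
have := expR_gt0 (2 * a).
move: (expR _) (expR (- (2 * a))) e3 e4 => E e' e3 e4 E0.
have h : E - 1 <= 2 * a * E.
  have : E * (1 + - (2 * a)) <= E * e' by rewrite ler_pM2l.
  by rewrite e4; lra.
rewrite ler_pdivrMr; last by lra.
by rewrite mulrDr mulr1; lra.
Qed.

Lemma tanh_gt0 a : 0 < a -> 0 < tanh a.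
Proof.
move=> a0; rewrite tanhE divr_gt0//; last by rewrite addr_gt0 ?expR_gt0.
by rewrite subr_gt0 ltr_expR; lra.
Qed.

End hyperbolic_bounds.

(** * The function F and its inverse *)

Section Finv_theory.
Context {R : realType}.
Variables (N : nat) (gamma alpha : R).
Hypotheses (N0 : (0 < N)%N) (gamma0 : 0 < gamma).
Hypothesis alphaN : alpha < N%:R * tanh (gamma / N%:R).

Local Notation tau := (tanh (gamma / N%:R)).

Let NR0 : 0 < N%:R :> R.
Proof. by rewrite ltr0n. Qed.

Let tau0 : 0 < tau.
Proof. by rewrite tanh_gt0// divr_gt0. Qed.

Lemma Ffun_lower x : tau * x < 1 ->
  (N%:R * tau - alpha) * x <= Ffun N gamma alpha x.
Proof.
move=> x1; rewrite /Ffun.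
have : ln (1 + - (tau * x)) <= - (tau * x) by apply: le_ln1Dx; lra.
move: (ln _) => l hl.
suff : N%:R * l <= N%:R * - (tau * x) by lra.
by rewrite ler_pM2l.
Qed.

Lemma Ffun_homo x y : 0 <= x -> x < y -> tau * y < 1 ->
  Ffun N gamma alpha x < Ffun N gamma alpha y.
Proof.
move=> x0 xy y1; rewrite /Ffun.
have xy' : tau * x < tau * y by rewrite ltr_pM2l.
have px : 0 < 1 - tau * x by lra.
have py : 0 < 1 - tau * y by lra.
have := @le_ln1Dx _ ((1 - tau * y) / (1 - tau * x) - 1).
rewrite addrCA subrr addr0 ltrBrDl subrr divr_gt0// => /(_ isT).
rewrite ln_div ?posrE// => hl.
have tx0 : 0 <= tau * x by rewrite mulr_ge0// ltW.
have hq : (1 - tau * y) / (1 - tau * x) - 1 <= - (tau * (y - x)).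
  have hd : 0 <= tau * (y - x) by rewrite mulr_ge0 ?subr_ge0 ?(ltW tau0) ?(ltW xy).
  rewrite lerBlDr ler_pdivrMr//; nra.
suff : alpha * (y - x) < N%:R * (ln (1 - tau * x) - ln (1 - tau * y)) by lra.
have : N%:R * (tau * (y - x)) <= N%:R * (ln (1 - tau * x) - ln (1 - tau * y)).
  by rewrite ler_pM2l//; lra.
apply: lt_le_trans; rewrite mulrA ltr_pM2r//; lra.
Qed.

Lemma Ffun_surj (z : R) : 0 <= z ->
  exists2 x, 0 <= x /\ tau * x < 1 & Ffun N gamma alpha x = z.
Proof.
move=> z0.
(* The substitution [x = (1 - expR (- s)) / tau] sends the half-open domain to [0 <= s] and makes
   the logarithm linear, so the intermediate value theorem applies on a segment. *)
pose g (s : R) := N%:R * s - alpha / tau * (1 - expR (- s)).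
have gE s : g s = Ffun N gamma alpha ((1 - expR (- s)) / tau).
  have tn : tau != 0 by rewrite gt_eqF.
  have -> : Ffun N gamma alpha ((1 - expR (- s)) / tau) =
      - (N%:R * ln (expR (- s))) - alpha * ((1 - expR (- s)) / tau).
    by congr (- (_ * ln _) - _); field.
  by rewrite expRK /g; field.
(* Chosen so that [N%:R * M] exceeds [z] by an upper bound of the [alpha] term of [g]. *)
pose M := (z + `|alpha| / tau) / N%:R.
have M0 : 0 <= M.
  by rewrite divr_ge0 ?(ltW NR0)// addr_ge0// divr_ge0 ?(ltW tau0).
have gc : continuous g.
  move=> s; apply: cvgB; first by apply: cvgM; [exact: cvg_cst|exact: cvg_id].
  apply: cvgM; first exact: cvg_cst.
  apply: cvgB; first exact: cvg_cst.
  by apply: (@continuous_comp _ _ _ -%R expR); [exact: opp_continuous|exact: continuous_expR].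
have g0 : g 0 = 0 by rewrite /g oppr0 expR0 subrr !mulr0 subr0.
have gM : z <= g M.
  have e0 := expR_gt0 (- M).
  have e1 : expR (- M) <= 1 by rewrite -expR0 ler_expR; lra.
  have NM : N%:R * M = z + `|alpha| / tau by rewrite /M mulrC divfK ?gt_eqF.
  have h1 : alpha / tau * (1 - expR (- M)) <= `|alpha| / tau * (1 - expR (- M)).
    by rewrite ler_wpM2r ?subr_ge0// ler_wpM2r ?invr_ge0 ?(ltW tau0)// ler_norm.
  have h2 : `|alpha| / tau * (1 - expR (- M)) <= `|alpha| / tau.
    by apply: ler_piMr; [exact: divr_ge0 (normr_ge0 _) (ltW tau0)|lra].
  by rewrite /g NM; lra.
have [s] : exists2 s, s \in `[0, M] & g s = z.
  apply: IVT => //; first by apply: continuous_subspaceT.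
  by rewrite g0 min_l ?max_r ?z0//; lra.
rewrite in_itv/= => /andP[s0 sM] gs; exists ((1 - expR (- s)) / tau); last by rewrite -gE.
have e0 := expR_gt0 (- s).
have e1 : expR (- s) <= 1 by rewrite -expR0 ler_expR; lra.
split; first by rewrite divr_ge0 ?(ltW tau0)// subr_ge0.
by rewrite mulrC divfK ?gt_eqF//; lra.
Qed.

(** Surjectivity onto the nonnegative reals ensures that the partial inverse does not return its
    default value. *)
Lemma FinvP (z : R) : 0 <= z ->
  [/\ 0 <= Finv N gamma alpha z, tau * Finv N gamma alpha z < 1 &
      Ffun N gamma alpha (Finv N gamma alpha z) = z].
Proof.
move=> z0; set A : set R := `[0, tau^-1[%classic.
have AE x : A x <-> 0 <= x /\ tau * x < 1.
  have -> : (tau * x < 1) = (x < tau^-1) by rewrite mulrC -ltr_pdivlMr// div1r.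
  rewrite /A /= in_itv/=.
  by split => [/andP[]|[-> ->]].
have surj : set_surj A [set z : R | 0 <= z] (Ffun N gamma alpha).
  by move=> y /= /Ffun_surj[x /AE Ax <-]; exists x.
have FA : A (Finv N gamma alpha z).
  by apply: (surjpinv_image_sub surj); exists z.
have [F0 F1] := (AE _).1 FA; split => //.
by apply: (surjpK _ surj); rewrite inE.
Qed.

Lemma Finv_ge (y z : R) : 0 <= z -> tau * y < 1 -> Ffun N gamma alpha y <= z ->
  y <= Finv N gamma alpha z.
Proof.
move=> z0 y1 Fyz; have [F0 F1 FE] := FinvP z0.
rewrite leNgt; apply/negP => lt; move: Fyz.
by rewrite leNgt -FE Ffun_homo.
Qed.

Lemma Finv_le (z : R) : 0 <= z ->
  (N%:R * tau - alpha) * Finv N gamma alpha z <= z.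
Proof. by move=> z0; have [F0 F1 FE] := FinvP z0; rewrite -[leRHS]FE Ffun_lower. Qed.

End Finv_theory.

(** * Cardinality of the dyadic grid and rounding to powers of two *)

Section grid_size.
Context {R : realType}.
Implicit Types (N k : nat).

Lemma ln2_gt0 : 0 < ln 2 :> R.
Proof. by rewrite ln_gt0// ltr1n. Qed.

Lemma ln2_ge : 1 / 2 <= ln 2 :> R.
Proof.
rewrite -[leLHS]expRK ler_ln ?posrE ?expR_gt0//.
have := @expR_le_quadratic R (1 / 2); rewrite ger0_norm; last by lra.
have h : 1 / 2 <= 1 :> R by lra.
by move=> /(_ h); rewrite [X in _ <= X -> _](_ : _ = 2)//; field.
Qed.

Lemma ln2_le1 : ln 2 <= 1 :> R.
Proof. by have := @le_ln1Dx R 1; rewrite (_ : 1 + 1 = 2)//; apply; lra. Qed.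

Lemma ln_exp2 k : ln (2 ^+ k) = k%:R * ln 2 :> R.
Proof. by rewrite lnXn// mulr_natl. Qed.

(** [up_log 2 N] is the ceiling of the binary logarithm, so it counts the admissible exponents. *)
Lemma grid_index N k : (1 < N)%N ->
  (k%:R < ln N%:R / ln 2 :> R) = (k < up_log 2 N)%N.
Proof.
move=> N1; have N0 : 0 < N%:R :> R by rewrite ltr0n ltnW.
rewrite ltr_pdivlMr ?ln2_gt0// -ln_exp2 ltr_ln ?posrE ?exprn_gt0//.
rewrite -natrX ltr_nat; apply/idP/idP => h.
  by rewrite ltnNge; apply/negP => /(leq_pexp2l (isT : 0 < 2)%N);
    rewrite leqNgt (leq_trans h)// up_logP.
by rewrite ltnNge; apply/negP => /(up_log_min (isT : 1 < 2)%N); rewrite leqNgt h.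
Qed.

Lemma Lambda2E N : (1 < N)%N ->
  Lambda2 N = [set (2 ^+ k : R) | k in `I_(up_log 2 N)].
Proof.
by move=> N1; congr (_ @` _); apply/seteqP; split => k /=; rewrite grid_index.
Qed.

Lemma exp2_inj : injective (fun k => 2 ^+ k : R).
Proof.
move=> j k /(congr1 (@ln R)); rewrite !ln_exp2 => /(mulIf _).
by rewrite gt_eqF ?ln2_gt0// => /(_ isT)/eqP; rewrite eqr_nat => /eqP.
Qed.

(** Counts the pairs [j < k] of grid exponents in the union bound; the factor 1/2 saves half of the
    confidence budget. *)
Lemma sum_ord_le (M : nat) : \sum_(k < M) k%:R <= M%:R ^+ 2 / 2 :> R.
Proof.
elim: M => [|M IH]; first by rewrite big_ord0 expr0n mul0r.
rewrite big_ord_recr/= -natr1; move: IH; have := ler0n R M; move: (\sum_(_ < _) _) (M%:R) => s m.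
by rewrite sqrrD mulr1 expr1n; lra.
Qed.

Lemma card_Lambda2 N : (1 < N)%N ->
  size (finmap.enum_fset (fset_set (Lambda2 N : set R))) = up_log 2 N.
Proof.
move=> N1; apply: card_fset_set; rewrite Lambda2E//.
by apply: inj_card_eq => j k _ _; exact: exp2_inj.
Qed.

Lemma nu2E N k : (1 < N)%N -> (k < up_log 2 N)%N ->
  nu2 N (2 ^+ k : R) = (up_log 2 N)%:R^-1.
Proof.
move=> N1 kN; rewrite /nu2 card_Lambda2// indicE mem_set ?div1r//.
by rewrite Lambda2E//; exists k.
Qed.

Lemma log_levelE (eps : R) N j k : 0 < eps -> (1 < N)%N ->
  (j < up_log 2 N)%N -> (k < up_log 2 N)%N ->
  log_level eps N (2 ^+ j) (2 ^+ k) = - ln ((up_log 2 N)%:R ^+ 2 / eps).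
Proof.
move=> e0 N1 jN kN; rewrite /log_level !nu2E// -lnV; last first.
  by rewrite posrE divr_gt0// exprn_gt0// ltr0n (leq_trans _ jN).
congr ln; field.
by rewrite gt_eqF//= pnatr_eq0 -lt0n (leq_trans _ jN).
Qed.

Lemma up_log2_le N : 1 <= ln N%:R :> R -> (up_log 2 N)%:R <= 3 * ln N%:R :> R.
Proof.
move=> N1; have N2 : (1 < N)%N.
  rewrite ltnNge; apply/negP => NN.
  by have := @ln_le0 R N%:R; rewrite lern1 NN => /(_ isT); lra.
have K0 : (0 < up_log 2 N)%N by rewrite up_log_gt0 N2.
have := grid_index (up_log 2 N).-1 N2; rewrite prednK// leqnn.
move/idP; rewrite ltr_pdivlMr ?ln2_gt0//.
rewrite -[in X in _ -> X](prednK K0) -[(up_log 2 N).-1.+1%:R]natr1.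
have : (up_log 2 N).-1%:R * (1 / 2) <= (up_log 2 N).-1%:R * ln 2 :> R.
  by rewrite ler_wpM2l// ln2_ge.
move: (_.-1%:R) => x; lra.
Qed.

(** Rounding down to a power of two costs less than 1 in the logarithm because [ln 2 <= 1]. *)
Lemma exp2_floor (y : R) : 0 <= y -> exists k : nat, y - 1 < ln (2 ^+ k) <= y.
Proof.
move=> y0; have l0 := ln2_gt0; have l1 := ln2_le1.
have := truncn_itv (divr_ge0 y0 (ltW l0)); set k := Num.truncn _ => /andP[h1 h2].
exists k; rewrite ln_exp2; apply/andP; split; last by rewrite -ler_pdivlMr.
move: h2; rewrite ltr_pdivrMr// -natr1 mulrDl mul1r; lra.
Qed.

End grid_size.

Section margin.
Context {R : realType}.

(* Young's inequality in the form produced by a margin assumption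
   [c * D `^ kappa <= s]: either [D] is below the threshold where the two sides
   balance, or the margin term dominates. *)
Lemma margin_young (b q c kappa D s : R) : 0 <= b -> 0 < q -> 0 < c -> 1 < kappa ->
  0 <= D -> c * D `^ kappa <= s ->
  b * D <= q * s + b * (b / (q * c)) `^ (kappa - 1)^-1.
Proof.
move=> b0 q0 c0 k1 D0 Ds; set y := _ `^ _.
have s0 : 0 <= s by apply: le_trans Ds; rewrite mulr_ge0 ?powR_ge0// ltW.
have [Dy|yD] := leP D y.
  by apply: ler_wpDl; [rewrite mulr_ge0// ltW|exact: ler_wpM2l].
have D1 : 0 < D by apply: le_lt_trans yD; exact: powR_ge0.
have k10 : 0 < kappa - 1 by rewrite subr_gt0.
have bq0 : 0 <= b / (q * c) by rewrite divr_ge0// mulr_ge0 ?ltW.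
have h : b / (q * c) <= D `^ (kappa - 1).
  have -> : b / (q * c) = y `^ (kappa - 1).
    by rewrite /y -powRrM mulVf ?gt_eqF// powRr1.
  by apply: ge0_ler_powR; rewrite ?nnegrE ?powR_ge0 ?(ltW k10) ?(ltW yD) ?(ltW D1).
apply: ler_wpDr; first by rewrite mulr_ge0 ?powR_ge0.
apply: (@le_trans _ _ (q * (c * D `^ kappa))); last by rewrite ler_pM2l.
have -> : D `^ kappa = D `^ (kappa - 1) * D.
  rewrite -[X in _ = _ * X]powRr1 ?(ltW D1)// -powRD ?subrK//.
  by apply/implyP => _; rewrite gt_eqF.
by rewrite !mulrA ler_wpM2r ?(ltW D1)// -ler_pdivrMl ?mulr_gt0// mulrC.
Qed.

End margin.

(** * Choice of the temperatures *)

Section rates.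
Context {R : realType}.
Variables (kappa c d eps A S x0 : R).
Hypotheses (kappa1 : 1 < kappa) (c0 : 0 < c) (d0 : 0 < d) (eps01 : 0 < eps < 1).
Hypotheses (A1 : 1 <= A) (S0 : 0 <= S) (x00 : 0 < x0).

Local Notation e := ((kappa - 1)^-1).
Local Notation u := (kappa / (2 * kappa - 1)).

Let e0 : 0 < e.
Proof. by rewrite invr_gt0 subr_gt0. Qed.

Let uE : u = (1 + e) / (2 + e).
Proof.
have k1 : kappa - 1 != 0 by rewrite gt_eqF// subr_gt0.
have k2 : 2 * (kappa - 1) + 1 != 0.
  by rewrite gt_eqF// addr_gt0// mulr_gt0// subr_gt0.
by field; rewrite k1 k2.
Qed.

(* The exponents of [ln (ln N)] in the temperatures: gamma is of order
   [N `^ u * L `^ - a] and gamma / beta of order [L `^ (1 + eta)]. *)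
Lemma rate_exponents : exists a eta : R,
  [/\ 0 <= a, 0 < eta, (1 + eta) * e - (2 + e) * a <= 1 & a + 1 + 2 * eta = 2 * u].
Proof.
rewrite uE; move: (e) e0 => x x0'.
(* As [2 * u - 1] is [x / (2 + x)], the last equation forces [a] once [eta] is known; the third
   condition then reads [eta * (4 + 3 * x) <= 1], and [eta] is small enough for it and for
   [0 <= a]. *)
exists (x / (2 + x) - 2 * (x / (3 * (1 + x) * (2 + x)))), (x / (3 * (1 + x) * (2 + x))).
have p1 : 0 < 1 + x by lra.
have p2 : 0 < 2 + x by lra.
have n1 : 1 + x != 0 by rewrite gt_eqF.
have n2 : 2 + x != 0 by rewrite gt_eqF.
split.
- have -> : x / (2 + x) - 2 * (x / (3 * (1 + x) * (2 + x))) =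
    x * (1 + 3 * x) / (3 * (1 + x) * (2 + x)) by field; rewrite n1 n2.
  by rewrite divr_ge0// !mulr_ge0//; lra.
- by rewrite divr_gt0// !mulr_gt0.
- have -> : (1 + x / (3 * (1 + x) * (2 + x))) * x -
      (2 + x) * (x / (2 + x) - 2 * (x / (3 * (1 + x) * (2 + x)))) =
      x * (4 + 3 * x) / (3 * (1 + x) * (2 + x)) by field; rewrite n1 n2.
  by rewrite ler_pdivrMr ?mulr_gt0//; nra.
- by field; rewrite n1 n2.
Qed.

Let powRE (x y : R) : 0 < x -> x `^ y = expR (y * ln x).
Proof. by move=> x0'; rewrite /powR gt_eqF. Qed.

Lemma ln_large (M : R) : exists N1 : nat, forall N : nat, (N1 <= N)%N -> M <= ln N%:R.
Proof.
exists (Num.truncn (expR M)).+1 => N NN.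
have h : expR M < N%:R by apply: (lt_le_trans (truncnS_gt _)); rewrite ler_nat.
have N0 : 0 < N%:R :> R by apply: lt_trans h; exact: expR_gt0.
by rewrite -[M]expRK ler_ln ?posrE ?expR_gt0// ltW.
Qed.

(** With [g] and [n] the logarithms of gamma and [N], a remainder is a constant times the
    exponential of a linear form. *)
Let remainder_ratio (K g n h : R) : 0 < K ->
  10 * expR g ^+ 2 / expR n * (K * expR g * expR h / (expR n * c)) `^ e =
  10 * (K / c) `^ e * expR ((2 + e) * g - (1 + e) * n + e * h).
Proof.
move=> K0; have p : 0 < K / c by rewrite divr_gt0.
have -> : K * expR g * expR h / (expR n * c) = (K / c) * expR (g + h - n).
  rewrite expRD expRD expRN; field.
  by rewrite !gt_eqF ?expR_gt0.
rewrite powRM ?(ltW p) ?expR_ge0// [expR (g + h - n) `^ _]powRE ?expR_gt0// expRK.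
have -> : expR ((2 + e) * g - (1 + e) * n + e * h) =
    expR g ^+ 2 / expR n * expR (e * (g + h - n)).
  by rewrite -expRM_natl -expRN -!expRD; congr expR; ring.
by move: (_ `^ _) (expR (e * _)) (expR g) (expR n)^-1 => *; ring.
Qed.

(** At [g = u * n] the exponent [(2 + e) * g - (1 + e) * n] vanishes; this balance is what
    determines the exponent [u]. *)
Let u_mul (n : R) : (2 + e) * (u * n) = (1 + e) * n.
Proof. by rewrite mulrA uE [_ * (_ / _)]mulrC divfK// gt_eqF// addr_gt0. Qed.

Lemma remainder_le (a n l g : R) : 0 <= a -> 0 <= l -> g <= u * n - a * l ->
  10 * expR g ^+ 2 / expR n * (40 * expR g / (expR n * c)) `^ e <= 10 * (40 / c) `^ e.
Proof.
move=> a0 l0 gle; have -> : 40 * expR g / (expR n * c) = 40 * expR g * expR 0 / (expR n * c).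
  by rewrite expR0 mulr1.
rewrite remainder_ratio// mulr0 addr0 ler_piMr ?mulr_ge0 ?powR_ge0//.
rewrite -[leRHS]expR0 ler_expR.
have h : (2 + e) * g <= (2 + e) * (u * n).
  by rewrite ler_wpM2l ?addr_ge0 ?(ltW e0)// (le_trans gle)// lerBlDr lerDl mulr_ge0.
by rewrite subr_le0 (le_trans h)// u_mul.
Qed.

(** Here [h] is the logarithm of beta. The ratio gamma / beta enters to the power [e], and the third
    condition of [rate_exponents] keeps the outcome of order [expR l], that is, of order [L]. *)
Lemma slow_remainder_le (a eta n l g h : R) : 0 <= l ->
  (1 + eta) * e - (2 + e) * a <= 1 ->
  g <= u * n - a * l -> g - h <= (1 + eta) * l + 1 ->
  10 * expR g ^+ 2 / expR n * (20 * expR g ^+ 2 / (expR n * expR h * c)) `^ e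
  <= 10 * (20 / c) `^ e * expR e * expR l.
Proof.
move=> l0 hab gle ghl.
have -> : 20 * expR g ^+ 2 / (expR n * expR h * c) =
    20 * expR g * expR (g - h) / (expR n * c).
  by rewrite expRD expRN; field; rewrite !gt_eqF ?expR_gt0.
rewrite remainder_ratio// -[leRHS]mulrA -expRD ler_wpM2l ?mulr_ge0 ?powR_ge0//.
rewrite ler_expR.
have h1 : (2 + e) * g <= (2 + e) * (u * n - a * l).
  by rewrite ler_wpM2l ?addr_ge0 ?(ltW e0).
have h2 : e * (g - h) <= e * ((1 + eta) * l + 1) by rewrite ler_wpM2l ?(ltW e0).
have h3 := u_mul n.
have h4 : ((1 + eta) * e - (2 + e) * a) * l <= 1 * l by rewrite ler_wpM2r.
move: h1 h2 h3 h4; move: (e) (u) => x y *; lra.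
Qed.

Let u01 : 0 < u < 1.
Proof.
by rewrite uE ltr_pdivrMr ?divr_gt0 ?addr_gt0//= ?mul1r ?ltrD2r ?ltr1n//.
Qed.

(* [n] stands for [ln N]. *)
Let loglog_le (n : R) (del : R) : 0 < del -> 0 < n -> 0 < ln (n / eps) ->
  ln (ln (n / eps)) <= del * n + (- ln del - ln eps).
Proof.
move=> del0 n0 L0; have /andP[e0' _] := eps01.
have h1 := ln_sublinear L0.
have h2 := ln_sublinear (mulr_gt0 del0 n0).
rewrite lnM ?posrE// in h2; rewrite ln_div ?posrE// in h1 *; lra.
Qed.

(** [constX] gathers the constants of the final rate, in logarithmic form, and [constM] those of the
    slope inequality. Each is absorbed by the spare factor [expR (eta * l)]. *)
Let constX := ln (4 * d) + 4 + ln c / (2 * kappa - 1) + u * ln d.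
Let constM := (24 * d + 10 * S + 10 * (20 / c) `^ e * expR e + 12) * (2 * A).

Let constM_gt0 : 0 < constM.
Proof.
have A0 : 0 < A by apply: lt_le_trans A1.
rewrite /constM mulr_gt0// ?mulr_gt0//.
apply: ltr_wpDl => //; apply: addr_ge0; last by rewrite !mulr_ge0 ?powR_ge0 ?expR_ge0.
by apply: addr_ge0; rewrite mulr_ge0// ltW.
Qed.

Let log_thresholds (a eta : R) : 0 <= a -> 0 < eta -> a + 1 + 2 * eta = 2 * u ->
  exists nmin : R, 1 <= nmin /\ forall n, nmin <= n ->
  let L := ln (n / eps) in let l := ln L in
  [/\ 1 <= L, 0 <= l, ln A <= l, ln constM <= eta * l & constX <= eta * l] /\
  [/\ 1 <= (1 - u) * n, ln x0 <= u * n - (a + (1 + eta)) * l - 4 &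
      0 <= u * n - (a + (1 + eta)) * l - 4].
Proof.
move=> a0 eta0 aE; have /andP[u0 u1] := u01; have /andP[eps0 eps1] := eps01.
(* [lmin] serves the lower bounds on [l]. In [nmin], the double exponential gives [lmin <= l], the
   inverse gives [1 <= (1 - u) * n], and the last fraction lets [u * n] dominate [2 * l], as
   [loglog_le] bounds [l] by [u / 8 * n] plus a constant. *)
pose lmin := `|ln A| + `|ln constM| / eta + `|constX| / eta.
pose C1 := - ln (u / 8) - ln eps.
pose nmin := 1 + expR (expR lmin) + (1 - u)^-1 + (`|ln x0| + 4 + 2 * `|C1|) / (u / 2).
have u1' : 0 < 1 - u by rewrite subr_gt0.
have t1 : 0 <= `|ln A| by [].
have t2 : 0 <= `|ln constM| / eta by rewrite divr_ge0// ltW.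
have t3 : 0 <= `|constX| / eta by rewrite divr_ge0// ltW.
have p1 := expR_gt0 (expR lmin).
have p2 : 0 < (1 - u)^-1 by rewrite invr_gt0.
have u20 : 0 < u / 2 by apply: divr_gt0.
have p3 : 0 <= (`|ln x0| + 4 + 2 * `|C1|) / (u / 2).
  by apply: divr_ge0; [rewrite !addr_ge0// mulr_ge0|exact: ltW].
exists nmin; split; first by rewrite /nmin; lra.
move=> n nn L l.
have n1 : 1 <= n by rewrite /nmin in nn; lra.
have n0 : 0 < n by lra.
have L1 : expR lmin <= L.
  rewrite /L -[leLHS]expRK ler_ln ?posrE ?expR_gt0 ?divr_gt0//.
  apply: (@le_trans _ _ n); first by rewrite /nmin in nn; lra.
  by rewrite ler_pdivlMr// ler_piMr// ltW.
have lm0 : 0 <= lmin by rewrite /lmin; lra.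
have L1' : 1 <= L.
  by apply: le_trans L1; have := expR_ge1Dx lmin; lra.
have L0 : 0 < L by lra.
have ll : lmin <= l by rewrite /l -[leLHS]expRK ler_ln ?posrE ?expR_gt0.
have l0 : 0 <= l by exact: le_trans ll.
have q2 : `|ln constM| / eta <= l by apply: le_trans ll; rewrite /lmin; lra.
have q3 : `|constX| / eta <= l by apply: le_trans ll; rewrite /lmin; lra.
have q4 : (`|ln x0| + 4 + 2 * `|C1|) / (u / 2) <= n.
  by apply: le_trans nn; rewrite /nmin; lra.
have q5 : (1 - u)^-1 <= n by apply: le_trans nn; rewrite /nmin; lra.
have u80 : 0 < u / 8 by apply: divr_gt0.
have lle : l <= u / 8 * n + C1 := loglog_le u80 n0 L0.
rewrite ler_pdivrMr// mulrC in q2; rewrite ler_pdivrMr// mulrC in q3.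
rewrite ler_pdivrMr// in q4.
have C1n := ler_norm C1; have x0n := ler_norm (ln x0).
have x0n0 : 0 <= `|ln x0| by [].
have key : `|ln x0| <= u * n - (a + (1 + eta)) * l - 4.
  have : (a + (1 + eta)) * l <= 2 * l by rewrite ler_wpM2r//; lra.
  rewrite (_ : n * (u / 2) = u * n / 2) in q4; last by rewrite mulrA [n * u]mulrC.
  rewrite (_ : u / 8 * n = u * n / 8) in lle; last by rewrite mulrAC.
  have un0 : 0 <= u * n by rewrite mulr_ge0// ltW.
  move: q4 lle un0; move: (u * n) => y; lra.
split; split => //.
- by apply: le_trans (ler_norm _) _; apply: le_trans ll; rewrite /lmin; lra.
- exact: le_trans (ler_norm _) q2.
- exact: le_trans (ler_norm _) q3.
- by rewrite mulrC -ler_pdivrMr// div1r.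
- exact: le_trans (ler_norm _) key.
- exact: le_trans key.
Qed.

(** All conditions become linear inequalities between logarithms: [n] for [N], [g] for gamma, [h]
    for beta, and [l] for [L]. *)
Lemma rate_parameters : exists N1 : nat, forall N : nat, (N1 <= N)%N ->
  exists j k : nat, let beta : R := 2 ^+ j in let gamma : R := 2 ^+ k in
  [/\ (1 < N)%N, gamma <= N%:R / 2, A * (4 * beta) <= gamma & x0 <= beta] /\
  [/\ 10 * gamma ^+ 2 / N%:R * (40 * gamma / (N%:R * c)) `^ e <= 10 * (40 / c) `^ e,
      24 * d + 10 * S
      + 10 * gamma ^+ 2 / N%:R * (20 * gamma ^+ 2 / (N%:R * (4 * beta) * c)) `^ e
      + 3 / 2 * ln ((up_log 2 N)%:R ^+ 2 / eps) <= gamma / (2 * A * (4 * beta)) &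
      4 * d / beta <= c `^ (- (2 * kappa - 1)^-1)
        * (1 + d^-1 * ln (ln N%:R / eps)) `^ (2 * kappa / (2 * kappa - 1))
        * (d / N%:R) `^ u].
Proof.
have [a [eta [a0 eta0 ae aeta]]] := rate_exponents.
(* The final rate in logarithms: the equation on exponents, multiplied by [l], leaves a surplus
   [eta * l] on the right for the constants. *)
have aux (p v uu n l h ld lcc : R) : a + 1 + 2 * eta = 2 * uu ->
    p + 4 + lcc * v + uu * ld <= eta * l -> uu * n - (a + (1 + eta)) * l - 4 <= h ->
    p - h <= - v * lcc + 2 * uu * (l - ld) + uu * (ld - n).
  by move=> E; have := congr1 ( *%R^~ l) E; rewrite /=; lra.
have {}aux := aux _ _ u _ _ _ _ _ aeta.
have [nmin [nmin1 thr]] := log_thresholds a0 eta0 aeta.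
have [N1 N1P] := ln_large nmin; exists N1 => N NN.
have nn := N1P N NN; set n := ln N%:R in nn *.
have [] := thr n nn; set L := ln (n / eps); set l := ln L.
move=> [L1 l0 lA lM lX] [t1 t2 t3].
have n1 : 1 <= n by exact: le_trans nn.
have N2 : (1 < N)%N.
  rewrite ltnNge; apply/negP => NN1.
  have := @ln_le0 R N%:R; rewrite lern1 NN1 -/n => /(_ isT) /(le_trans n1).
  by rewrite lt_geF.
have NR0 : 0 < N%:R :> R by rewrite ltr0n ltnW.
have NE : N%:R = expR n by rewrite /n lnK ?posrE.
have l20 := @ln2_le1 R; have l2g := @ln2_gt0 R.
have ln4 : ln 4 = 2 * ln 2 :> R.
  by rewrite (_ : 4 = 2 * 2)// ?lnM ?posrE//; lra.
have al0 : 0 <= (1 + eta) * l by rewrite mulr_ge0// addr_ge0// ltW.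
have y0 : 0 <= u * n - a * l by move: t3 al0; rewrite mulrDl; move: (u * n) => un *; lra.
(* Gamma is [expR (u * n - a * l)] rounded down to a power of two. *)
have [k /andP[g1 g2]] := exp2_floor y0; set g := ln (2 ^+ k) in g1 g2.
have y1 : 0 <= g - (1 + eta) * l - ln 4.
  by move: t3 g1; rewrite mulrDl ln4; move: (u * n) => un *; lra.
(* Beta is gamma divided by [4 * expR ((1 + eta) * l)], rounded down; the 4 anticipates
   [lambda_2 = 4 * beta]. *)
have [j /andP[h1 h2]] := exp2_floor y1; set h := ln (2 ^+ j) in h1 h2.
have gE : 2 ^+ k = expR g by rewrite /g lnK ?posrE ?exprn_gt0.
have hE : 2 ^+ j = expR h by rewrite /h lnK ?posrE ?exprn_gt0.
have h4E : 4 * expR h = expR (ln 4 + h) by rewrite expRD lnK ?posrE.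
have hlow : u * n - (a + (1 + eta)) * l - 4 <= h.
  by move: g1 h1; rewrite ln4 mulrDl; move: (u * n) => un *; lra.
have A0 : 0 < A by exact: lt_le_trans A1.
have hl : ln A <= (1 + eta) * l.
  by rewrite (le_trans lA)// mulrDl mul1r lerDl mulr_ge0// ltW.
exists j, k; rewrite gE hE NE; split; split => //.
- rewrite -[X in _ / X](@lnK R 2) ?posrE// -expRN -expRD ler_expR.
  have : g <= u * n by rewrite (le_trans g2)// lerBlDr lerDl mulr_ge0.
  by move: t1; rewrite mulrBl mul1r; move: (u * n) => un *; lra.
- rewrite h4E -[A]lnK ?posrE// -expRD ler_expR; lra.
- rewrite -[x0]lnK ?posrE// ler_expR; exact: le_trans hlow.
- exact: remainder_le l0 g2.
- have hg : g - (ln 4 + h) <= (1 + eta) * l + 1 by lra.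
  have R1 := slow_remainder_le l0 ae g2 hg.
  have K0 : 0 < (up_log 2 N)%:R :> R by rewrite ltr0n up_log_gt0 N2.
  have /andP[eps0 eps1] := eps01.
  (* The grid has at most [3 * n] elements and [ln 3 <= 3]. Multiplied by [3 / 2], the bound [8 * L]
     produces the summand 12 of [constM]. *)
  have R2 : ln ((up_log 2 N)%:R ^+ 2 / eps) <= 8 * L.
    rewrite ln_div ?posrE ?exprn_gt0// lnXn//.
    have n0 : 0 < n by exact: lt_le_trans n1.
    have : ln (up_log 2 N)%:R <= ln (3 * n).
      rewrite ler_ln ?posrE ?mulr_gt0//; exact: up_log2_le.
    rewrite lnM ?posrE// => k1.
    have k2 := @ln_sublinear R 3 ltac:(by []).
    have k3 : ln eps <= 0 by rewrite ln_le0// ltW.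
    move: L1; rewrite /L ln_div ?posrE//; lra.
  rewrite h4E (_ : L = expR l) in R2 *; last by rewrite /l lnK// posrE; lra.
  have el1 : 1 <= expR l by rewrite -[leLHS]expR0 ler_expR.
  have Sd : 24 * d + 10 * S <= (24 * d + 10 * S) * expR l.
    by rewrite ler_peMr// addr_ge0// mulr_ge0// ltW.
  apply: (@le_trans _ _ ((24 * d + 10 * S + 10 * (20 / c) `^ e * expR e + 12) * expR l)).
    rewrite [leRHS]mulrDl; apply: lerD; last by move: R2; lra.
    by rewrite [leRHS]mulrDl; exact: lerD.
  have -> : expR g / (2 * A * expR (ln 4 + h)) = expR (g - (ln 4 + h)) / (2 * A).
    by rewrite [expR (g - _)]expRD expRN; field; rewrite !gt_eqF ?expR_gt0.
  rewrite ler_pdivlMr ?mulr_gt0// mulrAC -/constM.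
  rewrite -[constM]lnK ?posrE// -expRD ler_expR.
  by move: h2 lM; rewrite mulrDl mul1r; lra.
have L0 : 0 < L by exact: lt_le_trans L1.
have k20 : 0 < 2 * kappa - 1.
  by rewrite subr_gt0; apply: lt_trans kappa1 _; rewrite ltr_pMl ?ltr1n// (lt_trans ltr01).
rewrite -expRN -[4 * d]lnK ?posrE ?mulr_gt0// -expRD.
apply: (@le_trans _ _ (expR (- (2 * kappa - 1)^-1 * ln c + 2 * u * (l - ln d)
    + u * (ln d - n)))).
  by rewrite ler_expR; exact: aux lX hlow.
have Ld0 : 0 < L / d by rewrite divr_gt0.
rewrite 2!expRD -(powRE _ c0); apply: ler_pM; rewrite ?mulr_ge0 ?powR_ge0 ?expR_ge0//.
  apply: ler_wpM2l; first exact: powR_ge0.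
  apply: (@le_trans _ _ ((L / d) `^ (2 * kappa / (2 * kappa - 1)))).
    by rewrite powRE// ln_div ?posrE// -[2 * kappa / _]mulrA.
  apply: ge0_ler_powR; rewrite ?nnegrE ?(ltW Ld0)//.
  - by rewrite divr_ge0 ?(ltW k20)// mulr_ge0// ltW// (lt_trans ltr01).
  - by rewrite addr_ge0// mulrC ltW.
  - by rewrite mulrC lerDr.
rewrite powRE ?divr_gt0 ?expR_gt0// ln_div ?posrE ?expR_gt0// expRK.
exact: lexx.
Qed.

End rates.

(** * PAC-Bayesian inequalities *)

Section bool_event.
Context d (T : measurableType d) (R : realType) (b : T -> bool).
Hypothesis bb : bmf (fun x => (b x)%:R : R).

Lemma measurable_bool_event : measurable [set x | b x].
Proof.
have := bb.1 measurableT _ (measurable_itv `]0, +oo[).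
rewrite setTI; congr measurable; apply/seteqP; split => x /=;
  by rewrite in_itv/= andbT ltr0n lt0b.
Qed.

Lemma int_bool_event (Q : probability T R) :
  \int[Q]_x (b x)%:R = fine (Q [set x | b x]).
Proof.
rewrite -bmf_int_indic; last exact: measurable_bool_event.
apply: eq_Rintegral => x _; rewrite indicE; congr (nat_of_bool _)%:R.
by apply/idP/idP; rewrite inE.
Qed.

End bool_event.

(** * Measurability of errors and empirical quantities *)

Section learning.
Context dX (X : measurableType dX) dY (Y : measurableType dY).
Context dT (Theta : measurableType dT) (R : realType).
Variables (f : Theta -> X -> Y) (pi : probability Theta R).
Hypothesis finY : finite_set [set: Y].
Hypothesis mY : forall A : set Y, measurable A.
Hypothesis mf : measurable_fun [set: Theta * X] (fun z => f z.1 z.2).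

(** A set of pairs is a finite union of products of singletons. This makes every event comparing two
    labels measurable. *)
Lemma measurable_finite_pair (A : set (Y * Y)) : measurable A.
Proof.
rewrite (_ : A = \bigcup_(p in A) ([set p.1] `*` [set p.2])).
  apply: fin_bigcup_measurable => [|p _]; last exact: measurableX.
  apply: (sub_finite_set (@subsetT _ A)).
  by rewrite -setXTT; exact: finite_setX.
apply/seteqP; split => [p Ap|[p q] [[a b] Aab [/= -> ->]]] //.
by exists p.
Qed.

Section label_measurability.
Context dS (S : measurableType dS).

Lemma bmf_neq (u v : S -> Y) : measurable_fun [set: S] u ->
  measurable_fun [set: S] v -> bmf (fun s => (u s != v s)%:R : R).
Proof.
move=> mu mv.
have muv := measurable_fun_pair mu mv.
have := muv measurableT _ (measurable_finite_pair [set p | p.1 != p.2]).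
rewrite setTI => /(bmf_indic R).
congr bmf; apply/funext => s; rewrite indicE; congr (nat_of_bool _)%:R.
by apply/idP/idP; rewrite inE.
Qed.

Variable g : S -> Theta.
Hypothesis mg : measurable_fun [set: S] g.

Lemma measurable_predict (k : S -> X) : measurable_fun [set: S] k ->
  measurable_fun [set: S] (fun s => f (g s) (k s)).
Proof. by move=> mk; exact: (measurableT_comp mf (measurable_fun_pair mg mk)). Qed.

Lemma bmf_err (k : S -> X * Y) : measurable_fun [set: S] k ->
  bmf (fun s => (f (g s) (k s).1 != (k s).2)%:R : R).
Proof.
by move=> mk; apply: bmf_neq; [apply: measurable_predict|]; exact: measurableT_comp mk.
Qed.

End label_measurability.

(** A polynomial form of the absolute value, so that measurability follows from that of sums and
    products. *)
Lemma normr_sub_bool (a b : bool) :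
  `|a%:R - b%:R| = a%:R + b%:R - 2 * (a%:R * b%:R) :> R.
Proof. by case: a; case: b; rewrite /= ?subr0 ?sub0r ?subrr ?normrN ?normr1 ?normr0; ring. Qed.

Section empirical_measurability.
Context dS (S : measurableType dS) (N : nat).
Variables (k : S -> N.-tuple (X * Y)) (g g' : S -> Theta).
Hypotheses (mk : measurable_fun [set: S] k) (mg : measurable_fun [set: S] g)
  (mg' : measurable_fun [set: S] g').

Let bmf_err_tnth (h : S -> Theta) (i : 'I_N) : measurable_fun [set: S] h ->
  bmf (fun s => (f (h s) (tnth (k s) i).1 != (tnth (k s) i).2)%:R : R).
Proof.
move=> mh; apply: (bmf_err mh).
exact: (measurableT_comp (measurable_tnth i)).
Qed.

Lemma bmf_emp_risk : bmf (fun s => emp_risk R f (k s) (g s)).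
Proof. by apply: bmfZ; apply: bmf_sum => i; exact: bmf_err_tnth. Qed.

Lemma bmf_emp_dist : bmf (fun s => emp_dist R f (k s) (g s) (g' s)).
Proof.
apply: bmfZ; apply: bmf_sum => i.
under [X in bmf X]funext do rewrite normr_sub_bool.
apply: bmfB; first by apply: bmfD; exact: bmf_err_tnth.
by apply: bmfZ; apply: bmfM; exact: bmf_err_tnth.
Qed.

End empirical_measurability.

(** * Exponential moments for a fixed pair of parameters *)

Section moments.
Variables (N : nat) (PP : probability (N.-tuple (X * Y)) R).
Variable P : 'I_N -> probability (X * Y)%type R.
Hypothesis prodPP : is_product_measure PP P.

Let e t (z : X * Y) : R := (f t z.1 != z.2)%:R.
Let dd t t' (z : X * Y) : R := (f t z.1 != f t' z.1)%:R.

Let be t : bmf (e t).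
Proof. exact: (@bmf_err _ _ (fun=> t)). Qed.

Let bdd t t' : bmf (dd t t').
Proof.
by apply: bmf_neq; apply: measurable_predict => //; exact: measurable_cst.
Qed.

Let riskE t : risk f PP t = N%:R^-1 * \sum_(i < N) \int[P i]_z e t z.
Proof.
congr (_ * _); apply: eq_bigr => i _.
rewrite /e int_bool_event; last exact: be.
rewrite -(product_marginal prodPP i)//.
exact: (measurable_bool_event (be t)).
Qed.

Let disagreementE t t' :
  disagreement f PP t t' = N%:R^-1 * \sum_(i < N) \int[P i]_z dd t t' z.
Proof.
congr (_ * _); apply: eq_bigr => i _.
rewrite /dd int_bool_event; last exact: bdd.
rewrite -(product_marginal prodPP i)//.
exact: (measurable_bool_event (bdd t t')).
Qed.

Lemma bmf_risk : bmf (risk f PP).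
Proof.
rewrite (_ : risk f PP = fun t => N%:R^-1 * \sum_(i < N) \int[P i]_z e t z).
  apply: bmfZ; apply: bmf_sum => i.
  apply: (@bmf_int2 _ Theta _ _ _ pi (P i) (fun p : Theta * (X * Y) => e p.1 p.2)).
  exact: (@bmf_err _ _ fst).
by apply/funext => t; exact: riskE.
Qed.

Lemma risk_itv t : (0 < N)%N -> 0 <= risk f PP t <= 1.
Proof.
move=> N0; rewrite riskE; apply/andP; split.
  apply: mulr_ge0; first by rewrite invr_ge0.
  by apply: sumr_ge0 => i _; apply: Rintegral_ge0 => z _; rewrite /e.
rewrite mulrC ler_pdivrMr ?ltr0n// mul1r -[leRHS]mulr1 mulr_natl -[N in _ *+ N]card_ord -sumr_const.
apply: ler_sum => i _; apply: bmf_le_int_cst => // z.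
by rewrite /e; case: (_ != _).
Qed.

(** The three inequalities are the values 0, 1 and -1 of the difference of errors: they bound each
    factor by an affine function of that difference and of the disagreement. Independence multiplies
    the means, and [1 + y <= expR y] gathers them in one exponent. *)
Lemma moment_bound t t' (x0 x1 x2 s0 a b : R) : (0 < N)%N -> 0 <= b ->
  expR x0 <= s0 ->
  expR (x0 + x1 + x2) <= s0 + a + b ->
  expR (x0 - x1 + x2) <= s0 - a + b ->
  \int[PP]_w expR (N%:R * (x0 + x1 * (emp_risk R f w t - emp_risk R f w t')
                             + x2 * emp_dist R f w t t'))
  <= expR (N%:R * (s0 - 1 + a * (risk f PP t - risk f PP t')
                    + b * disagreement f PP t t')).
Proof.
move=> N0 b0 h0 hp hm.
have Nn0 : N%:R != 0 :> R by rewrite pnatr_eq0 -lt0n.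
pose G (k : bool * bool) : R :=
  expR (x0 + x1 * (k.1%:R - k.2%:R) + x2 * `|k.1%:R - k.2%:R|).
pose lab (z : X * Y) := (f t z.1 != z.2, f t' z.1 != z.2).
have -> : \int[PP]_w expR (N%:R * (x0 + x1 * (emp_risk R f w t - emp_risk R f w t')
                             + x2 * emp_dist R f w t t')) =
          \int[PP]_w \prod_(i < N) G (lab (tnth w i)).
  apply: eq_Rintegral => w _; rewrite -expR_sum; congr expR.
  rewrite !big_split/= sumr_const card_ord -!mulr_sumr sumrB /emp_risk /emp_dist.
  rewrite -mulr_natl; field.
  exact: Nn0.
have mlab k : measurable [set z | lab z = k].
  case: k => k1 k2.
  have mE c (u : Theta) : measurable [set z : X * Y | (f u z.1 != z.2) = c].
    have := measurable_bool_event (be u); case: c => //= mu.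
    rewrite (_ : [set _ | _] = ~` [set z | f u z.1 != z.2]); first exact: measurableC.
    by apply/seteqP; split => z /=; [move=> ->|move/negP/negbTE].
  rewrite (_ : [set _ | _] = [set z : X * Y | (f t z.1 != z.2) = k1] `&`
     [set z | (f t' z.1 != z.2) = k2]); first exact: measurableI.
  by apply/seteqP; split => z /=; rewrite /lab; [case=> -> ->|case=> <- <-].
rewrite (product_expectation prodPP G (lab := fun=> lab))//.
have bG i : bmf (fun z => G (lab z)) := (label_expectation (P i) G mlab).1.
pose q i := s0 + a * (\int[P i]_z e t z - \int[P i]_z e t' z) + b * \int[P i]_z dd t t' z.
have Gq i : \int[P i]_z G (lab z) <= q i.
  have bee := bmfB (be t) (be t').
  have -> : q i = \int[P i]_z (s0 + a * (e t z - e t' z) + b * dd t t' z).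
    rewrite bmf_intD; last exact: bmfZ.
      rewrite bmf_intD; [|exact: bmf_cst|exact: bmfZ].
      by rewrite prob_int_cst !bmf_intZ// bmf_intB.
    by apply: bmfD; [exact: bmf_cst|exact: bmfZ].
  apply: bmf_le_int; first exact: bG.
    by apply: bmfD; [apply: bmfD; [exact: bmf_cst|exact: bmfZ]|exact: bmfZ].
  move=> z; rewrite /G /lab /e /dd /=.
  have [E|NE] := eqVneq (f t z.1) (f t' z.1).
    by rewrite E subrr normr0 !mulr0 !addr0.
  case: (eqVneq (f t z.1) z.2) => E1; case: (eqVneq (f t' z.1) z.2) => E2 /=.
  - by rewrite E1 E2 eqxx in NE.
  - by rewrite sub0r normrN normr1 !mulr1 !mulrN1.
  - by rewrite subr0 normr1 !mulr1.
  (* Both predictions are wrong yet distinct: the errors agree while the disagreement is 1, which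
     [0 <= b] covers. *)
  - by rewrite subrr normr0 !mulr0 !addr0 mulr1; rewrite (le_trans h0)// lerDl.
apply: (@le_trans _ _ (\prod_(i < N) expR (q i - 1))).
  apply: ler_prod => i _; apply/andP; split.
    by apply: Rintegral_ge0 => z _; exact: expR_ge0.
  by rewrite (le_trans (Gq i))// (le_trans _ (expR_ge1Dx _))// addrC subrK.
rewrite -expR_sum ler_expR sumrB sumr_const card_ord !riskE disagreementE.
rewrite !big_split/= sumr_const card_ord -!mulr_sumr big_split/= sumrN.
rewrite -[1 *+ N]mulr_natl -[s0 *+ N]mulr_natl le_eqVlt; apply/orP; left; apply/eqP.
move: (\sum_(i < N) _) (\sum_(i < N) _) (\sum_(i < N) _) => u v y.
by field; exact: Nn0.
Qed.

End moments.

Section pair_exponent.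
Variables (N : nat) (Rk : Theta -> R) (gamma : R).
Hypotheses (N0 : (0 < N)%N) (bRk : bmf Rk) (Rk01 : forall t, 0 <= Rk t <= 1).
Hypothesis gamma0 : 0 < gamma.

Local Notation tau := (tanh (gamma / N%:R)).

(* The exponential of this quantity has expectation at most 1, because
   [exp (- a x - ln (cosh a) |x|) = 1 - tanh a * x] for [x] in [{-1, 0, 1}]. *)
Definition pair_exponent (w : N.-tuple (X * Y)) (t t' : Theta) : R :=
  N%:R * (- ln (1 - tau * (Rk t - Rk t'))
          + (- (gamma / N%:R)) * (emp_risk R f w t - emp_risk R f w t')
          + (- ln (cosh (gamma / N%:R))) * emp_dist R f w t t').

Lemma pair_exponentE w t t' : pair_exponent w t t' =
  - (N%:R * ln (1 - tau * (Rk t - Rk t')))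
  - gamma * (emp_risk R f w t - emp_risk R f w t')
  - N%:R * ln (cosh (gamma / N%:R)) * emp_dist R f w t t'.
Proof. by rewrite /pair_exponent; field; rewrite gt_eqF// ltr0n. Qed.

Lemma tanh_mul_lt1 (x : R) : x <= 1 -> tau * x < 1.
Proof.
move=> x1; have := tanh_lt1 (gamma / N%:R).
by apply: le_lt_trans; rewrite -[leRHS]mulr1 ler_pM2l// tanh_gt0// divr_gt0// ltr0n.
Qed.

Lemma bmf_pair_exponent dS (S : measurableType dS)
    (k : S -> N.-tuple (X * Y)) (g g' : S -> Theta) :
  measurable_fun [set: S] k -> measurable_fun [set: S] g ->
  measurable_fun [set: S] g' ->
  bmf (fun s => pair_exponent (k s) (g s) (g' s)).
Proof.
move=> mk mg mg'.
have bD : bmf (fun s => Rk (g s) - Rk (g' s)).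
  by apply: bmfB; exact: bmf_comp.
have br2 : bmf (fun s => emp_risk R f (k s) (g s) - emp_risk R f (k s) (g' s)).
  by apply: bmfB; exact: bmf_emp_risk.
have bm := bmf_emp_dist mk mg mg'.
apply: bmfZ; apply: bmfD; last exact: bmfZ.
apply: bmfD; last exact: bmfZ.
apply: bmfN; have bl := bmfB (@bmf_cst _ S R 1) (bmfZ tau bD).
split; first by apply: measurableT_comp; [exact: measurable_ln|exact: bl.1].
have tau0 : 0 < tau by rewrite tanh_gt0// divr_gt0// ltr0n.
exists (`|ln (1 - tau)| + `|ln (1 + tau)|) => s.
have /andP[p0 p1] := Rk01 (g s); have /andP[q0 q1] := Rk01 (g' s).
have t1 := tanh_lt1 (gamma / N%:R).
have [u1 u2] : - tau <= tau * (Rk (g s) - Rk (g' s)) /\ tau * (Rk (g s) - Rk (g' s)) <= tau.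
  by rewrite -{1}[tau]mulr1 -mulrN -{4}[tau]mulr1 !ler_pM2l//; lra.
have h1 : ln (1 - tau) <= ln (1 - tau * (Rk (g s) - Rk (g' s))).
  by rewrite ler_ln ?posrE; lra.
have h2 : ln (1 - tau * (Rk (g s) - Rk (g' s))) <= ln (1 + tau).
  by rewrite ler_ln ?posrE; lra.
rewrite ler_norml.
have := ler_norm (ln (1 + tau)); have := ler_norm (- ln (1 - tau)).
rewrite normrN; have := normr_ge0 (ln (1 + tau)).
have := normr_ge0 (ln (1 - tau)); lra.
Qed.

End pair_exponent.

(** * The bound B for a fixed sample *)

Section empirical_bound.
Variables (N : nat) (w : N.-tuple (X * Y)).
Variables (Rk : Theta -> R).
Hypotheses (N0 : (0 < N)%N) (bRk : bmf Rk) (Rk01 : forall t, 0 <= Rk t <= 1).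

Local Notation r := (emp_risk R f w).
Local Notation m' := (emp_dist R f w).
Local Notation Gr a := (fun t => - (a * r t)).
Local Notation GR b := (fun t => - (b * Rk t)).
Local Notation mu b := (gibbs pi (GR b)).
Local Notation Zr a := (partition pi (Gr a)).
Local Notation ZR b := (partition pi (GR b)).

Let NR0 : 0 < N%:R :> R.
Proof. by rewrite ltr0n. Qed.

Let br : bmf r.
Proof. exact: (@bmf_emp_risk _ _ _ (fun=> w) id). Qed.

Let bGr a : bmf (Gr a).
Proof. exact/bmfN/bmfZ. Qed.

Let bGR b : bmf (GR b).
Proof. exact/bmfN/bmfZ. Qed.

Let bm2 : bmf (fun p : Theta * Theta => m' p.1 p.2).
Proof. exact: (@bmf_emp_dist _ _ _ (fun=> w) fst snd). Qed.

Let bm1 t' : bmf (fun t => m' t t').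
Proof. exact: (@bmf_emp_dist _ _ _ (fun=> w) id (fun=> t')). Qed.

Let bm1r t : bmf (fun t' => m' t t').
Proof. exact: (@bmf_emp_dist _ _ _ (fun=> w) (fun=> t) id). Qed.

Let bmi (rho : probability Theta R) : bmf (fun t => \int[rho]_t' m' t t').
Proof. exact: (@bmf_int2 _ _ _ _ _ pi rho (fun p : Theta * Theta => m' p.1 p.2)). Qed.

Lemma emp_distC t t' : m' t t' = m' t' t.
Proof. by congr (_ * _); apply: eq_bigr => i _; rewrite distrC. Qed.

Lemma emp_dist_ge0 t t' : 0 <= m' t t'.
Proof. by rewrite mulr_ge0// ?invr_ge0// sumr_ge0. Qed.

(** An iterated integral, so that the change of measure acts on [t] inside and Jensen's inequality
    on [t'] outside. *)
Definition pair_moment (beta gamma : R) : R :=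
  \int[mu beta]_t' \int[mu beta]_t expR (pair_exponent Rk gamma w t t').

Section one_pair.
Variables (beta gamma : R).
Hypotheses (beta0 : 0 < beta) (gamma0 : 0 < gamma).

Local Notation tau := (tanh (gamma / N%:R)).
Local Notation lc := (N%:R * ln (cosh (gamma / N%:R))).

Let tau0 : 0 < tau.
Proof. by rewrite tanh_gt0// divr_gt0. Qed.

Let tau_lt1 (x : R) : x <= 1 -> tau * x < 1.
Proof. exact: tanh_mul_lt1. Qed.

Let bpe2 : bmf (fun p : Theta * Theta => pair_exponent Rk gamma w p.1 p.2).
Proof. exact: (bmf_pair_exponent N0 bRk Rk01 gamma0 (k := fun=> w)). Qed.

Lemma int_le1 (rho : probability Theta R) : \int[rho]_t Rk t <= 1.
Proof. by apply: bmf_le_int_cst => // t; have /andP[] := Rk01 t. Qed.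

Lemma int_ge0 (rho : probability Theta R) : 0 <= \int[rho]_t Rk t.
Proof. by apply: bmf_cst_le_int => // t; have /andP[] := Rk01 t. Qed.

(** [- ln (1 - tau * y)] is convex in [y], so the exponent is at least its linearization [psi] at
    the mean difference [x]. The Gibbs variational inequality replaces [mu beta] by [rho] in [t],
    Jensen's inequality handles [t'], and the terms in the slope [c1] cancel since [x] is the mean
    of [Rk t - Rk t']. *)
Lemma pac_bayes (a ell : R) (rho := gibbs pi (Gr a)) :
  pair_moment beta gamma <= expR ell ->
  ln (Zr a) - ln (ZR beta)
  - N%:R * ln (1 - tau * (\int[rho]_t Rk t - \int[mu beta]_t Rk t))
  - gamma * (\int[rho]_t r t - \int[mu beta]_t r t)
  - lc * (\int[mu beta]_t \int[rho]_t' m' t t')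
  + a * \int[rho]_t r t - beta * \int[rho]_t Rk t <= ell.
Proof.
have aux (lz lr l c u v y z q : R) :
    lz - lr - N%:R * l + c * (u - (u - y)) - gamma * v + a * v - beta * u
      + - c * y + gamma * z + - lc * q <= ell ->
    lz - lr - N%:R * l - gamma * (v - z) - lc * q + a * v - beta * u <= ell by lra.
move=> pm; set x := _ - \int[mu beta]_t Rk t.
have x1 : tau * x < 1.
  by apply: tau_lt1; rewrite lerBlDr (le_trans (int_le1 _))// lerDl int_ge0.
pose c1 := N%:R * tau / (1 - tau * x).
pose psi t t' := - (N%:R * ln (1 - tau * x)) + c1 * (Rk t - Rk t' - x)
   - gamma * (r t - r t') - lc * m' t t'.
have psi_le t t' : psi t t' <= pair_exponent Rk gamma w t t'.
  have /andP[p0 p1] := Rk01 t; have /andP[q0 q1] := Rk01 t'.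
  have y1 : tau * (Rk t - Rk t') < 1 by apply: tau_lt1; lra.
  rewrite /psi pair_exponentE//.
  suff : c1 * (Rk t - Rk t' - x) <=
      N%:R * ln (1 - tau * x) - N%:R * ln (1 - tau * (Rk t - Rk t')) by lra.
  have px : 0 < 1 - tau * x by lra.
  have py : 0 < 1 - tau * (Rk t - Rk t') by lra.
  have := @le_ln1Dx _ ((1 - tau * (Rk t - Rk t')) / (1 - tau * x) - 1).
  rewrite addrCA subrr addr0 ltrBrDl subrr divr_gt0// => /(_ isT).
  rewrite ln_div ?posrE// => hl.
  have -> : c1 * (Rk t - Rk t' - x) =
      N%:R * - ((1 - tau * (Rk t - Rk t')) / (1 - tau * x) - 1).
    by rewrite /c1; field; rewrite gt_eqF.
  by rewrite -mulrBr ler_pM2l//; lra.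
have bpsi t' : bmf (fun t => psi t t').
  apply: bmfB; last exact: bmfZ.
  apply: bmfB; last by apply: bmfZ; apply: bmfB => //; exact: bmf_cst.
  apply: bmfD; first exact: bmf_cst.
  by apply: bmfZ; apply: bmfB; [apply: bmfB => //; exact: bmf_cst|exact: bmf_cst].
have bpe t' : bmf (fun t => expR (pair_exponent Rk gamma w t t')).
  by apply: bmf_expR; exact: (bmf_pair2 t' bpe2).
pose K t' := ln (Zr a) + \int[rho]_t (GR beta t + psi t t' - Gr a t) - ln (ZR beta).
have KE t' : K t' = ln (Zr a) - ln (ZR beta) - N%:R * ln (1 - tau * x)
    + c1 * (\int[rho]_t Rk t - Rk t' - x) - gamma * (\int[rho]_t r t - r t')
    - lc * \int[rho]_t m' t t' + a * \int[rho]_t r t - beta * \int[rho]_t Rk t.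
  rewrite /K.
  have -> : (fun t => GR beta t + psi t t' - Gr a t) = (fun t =>
      (- (N%:R * ln (1 - tau * x)) + c1 * (- Rk t' - x) + gamma * r t')
      + (c1 - beta) * Rk t + (a - gamma) * r t + (- lc) * m' t t').
    by apply/funext => t; rewrite /psi; ring.
  rewrite (bmf_int_affine _ _ _ _ _ bRk br (bm1 t')).
  move: (\int[rho]_t Rk t) (\int[rho]_t r t) (\int[rho]_t m' t t') => u v y.
  by move: (ln (Zr a)) (ln (ZR beta)) (ln _) => *; ring.
have Kle t' : expR (K t') <= \int[mu beta]_t expR (pair_exponent Rk gamma w t t').
  have bg := bmfD (bGR beta) (bpsi t').
  have ZR0 : 0 < ZR beta by exact: partition_gt0.
  apply: (@le_trans _ _ (\int[mu beta]_t expR (psi t t'))).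
    rewrite (gibbs_int_expR pi (bGR beta) (bpsi t')).
    have -> : partition pi (fun t => GR beta t + psi t t') / ZR beta =
        expR (ln (partition pi (fun t => GR beta t + psi t t')) - ln (ZR beta)).
      by rewrite expRD expRN !lnK ?posrE ?partition_gt0.
    by rewrite ler_expR /K lerD2r ln_partition_ge.
  apply: bmf_le_int => //; first exact: bmf_expR.
  by move=> t; rewrite ler_expR.
have bmr : bmf (fun t' => \int[rho]_t m' t t').
  rewrite (_ : (fun t' => _) = (fun t' => \int[rho]_t m' t' t)); first exact: bmi.
  by apply/funext => t'; apply: eq_Rintegral => t _; exact: emp_distC.
pose c0 := ln (Zr a) - ln (ZR beta) - N%:R * ln (1 - tau * x)
  + c1 * (\int[rho]_t Rk t - x) - gamma * \int[rho]_t r t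
  + a * \int[rho]_t r t - beta * \int[rho]_t Rk t.
have c0E : c0 = ln (Zr a) - ln (ZR beta) - N%:R * ln (1 - tau * x)
  + c1 * (\int[rho]_t Rk t - x) - gamma * \int[rho]_t r t
  + a * \int[rho]_t r t - beta * \int[rho]_t Rk t by [].
have KE2 : K = fun t' => c0 + (- c1) * Rk t' + gamma * r t' + (- lc) * \int[rho]_t m' t t'.
  apply/funext => t'; rewrite KE /c0.
  move: (\int[rho]_t Rk t) (\int[rho]_t r t) (\int[rho]_t m' t t') => u v y.
  by move: (ln (Zr a)) (ln (ZR beta)) (ln _) => *; ring.
clearbody c0 c1; clear KE psi_le bpsi bpe; move: (K) KE2 Kle => {psi K} K KE2 Kle.
have b1 := bmfD (bmf_cst c0) (bmfZ (- c1) bRk).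
have b2 := bmfD b1 (bmfZ gamma br).
have bK : bmf K by rewrite KE2; apply: (bmfD b2); exact: bmfZ.
have bI : bmf (fun t' => \int[mu beta]_t expR (pair_exponent Rk gamma w t t')).
  apply: (@bmf_int1 _ Theta _ Theta _ (mu beta) (mu beta)
    (fun p : Theta * Theta => expR (pair_exponent Rk gamma w p.1 p.2))).
  by apply: bmf_expR; exact: bpe2.
have : \int[mu beta]_t' K t' <= ell.
  rewrite -ler_expR; apply: (le_trans (jensen_expR _ bK)).
  apply: (le_trans (bmf_le_int _ (bmf_expR bK) bI Kle)).
  exact: pm.
rewrite KE2 (bmf_int_affine _ _ _ _ _ bRk br bmr).
have -> : \int[mu beta]_t' \int[rho]_t m' t t' = \int[mu beta]_t \int[rho]_t' m' t t'.
  by apply: eq_Rintegral => t _; apply: eq_Rintegral => t' _; exact: emp_distC.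
rewrite c0E /x => H.
exact: aux H.
Qed.

Lemma log_momentE (l1 : R) (rho : probability Theta R) :
  log_moment f w (emp_gibbs f pi w l1) rho gamma =
  ln (partition pi (fun t => Gr l1 t + lc * \int[rho]_t' m' t t')) - ln (Zr l1).
Proof.
have bg := bmfZ lc (bmi rho).
have bG := bmfD (bGr l1) bg.
rewrite -ln_div ?posrE ?partition_gt0//; congr ln.
exact: (gibbs_int_expR pi (bGr l1) bg).
Qed.

(** The variational inequality tested at [mu beta]: it bounds the unobservable mean of [m'] under
    [mu beta] through an empirical log moment. *)
Lemma log_moment_lower (l1 : R) (rho : probability Theta R) :
  ln (ZR beta) - l1 * \int[mu beta]_t r t
    + lc * (\int[mu beta]_t \int[rho]_t' m' t t') + beta * \int[mu beta]_t Rk t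
  <= log_moment f w (emp_gibbs f pi w l1) rho gamma + ln (Zr l1).
Proof.
have bg := bmfZ lc (bmi rho).
have bG := bmfD (bGr l1) bg.
rewrite log_momentE subrK.
apply: le_trans (ln_partition_ge pi (bGR beta) bG).
have -> : (fun t => Gr l1 t + lc * (\int[rho]_t' m' t t') - GR beta t) =
    (fun t => 0 + beta * Rk t + (- l1) * r t + lc * \int[rho]_t' m' t t').
  by apply/funext => t; move: (\int[rho]_t' m' t t') => u; ring.
rewrite (bmf_int_affine _ _ _ _ _ bRk br (bmi rho)).
rewrite le_eqVlt; apply/orP; left; apply/eqP.
have aux (z u v q : R) : z - l1 * v + lc * q + beta * u =
  z + (0 + beta * u + - l1 * v + lc * q) by ring.
exact: aux.
Qed.

(** Sum of [pac_bayes] and [log_moment_lower], in which the means of [m'] cancel. The first three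
    terms on the right are the Kullback divergence of [kullback_emp_gibbs]. *)
Lemma gibbs_F_bound (a l1 ell : R) (rho := gibbs pi (Gr a)) :
  pair_moment beta gamma <= expR ell ->
  Ffun N gamma beta (\int[rho]_t Rk t - \int[mu beta]_t Rk t) <=
  (l1 - a) * \int[rho]_t r t - ln (Zr a) + ln (Zr l1)
  + log_moment f w (emp_gibbs f pi w l1) rho gamma + ell
  + (gamma - l1) * (\int[rho]_t r t - \int[mu beta]_t r t).
Proof.
have aux (lza lzr lz1 l u v y z q lm : R) :
    lzr - l1 * z + lc * q + beta * y <= lm + lz1 ->
    lza - lzr - N%:R * l - gamma * (v - z) - lc * q + a * v - beta * u <= ell ->
    - (N%:R * l) - beta * (u - y) <=
    (l1 - a) * v - lza + lz1 + lm + ell + (gamma - l1) * (v - z) by lra.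
move=> pm; rewrite /Ffun.
exact: (aux _ _ _ _ _ _ _ _ _ _ (log_moment_lower l1 rho) (pac_bayes a pm)).
Qed.

(** The sum of the two Kullback divergences between these Gibbs measures is nonnegative, and the
    partition functions cancel in it. *)
Lemma gibbs_risk_comparison (l2 : R) :
  l2 * (\int[gibbs pi (Gr l2)]_t r t - \int[mu beta]_t r t) <=
  beta * (\int[gibbs pi (Gr l2)]_t Rk t - \int[mu beta]_t Rk t).
Proof.
have aux (lz lzr u v y z : R) :
    lz + (0 + (- beta) * u + l2 * v + 0 * v) <= lzr ->
    lzr + (0 + beta * y + (- l2) * z + 0 * z) <= lz ->
    l2 * (v - z) <= beta * (u - y) by lra.
have P1 := ln_partition_ge pi (bGr l2) (bGR beta).
have P2 := ln_partition_ge pi (bGR beta) (bGr l2).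
apply: (aux (ln (Zr l2)) (ln (ZR beta))).
  rewrite -(bmf_int_affine _ 0 _ _ _ bRk br br); congr (_ + _ <= _): P1.
  by apply: eq_Rintegral => t _; ring.
rewrite -(bmf_int_affine _ 0 _ _ _ bRk br br); congr (_ + _ <= _): P2.
by apply: eq_Rintegral => t _; ring.
Qed.

Lemma log_moment_ge0 (nu rho : probability Theta R) :
  0 <= log_moment f w nu rho gamma.
Proof.
apply: (le_trans _ (jensen_ln nu (bmfZ lc (bmi rho)))).
apply: Rintegral_ge0 => t _; apply: mulr_ge0.
  by rewrite mulr_ge0// ln_cosh_ge0.
by apply: Rintegral_ge0 => t' _; exact: emp_dist_ge0.
Qed.

Lemma feasible_pos (l2 : R) : beta * gamma / N%:R * tau^-1 < l2 -> 0 < l2.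
Proof.
apply: le_lt_trans; rewrite mulr_ge0 ?invr_ge0 ?(ltW tau0)//.
by rewrite divr_ge0 ?(ltW NR0)// mulr_ge0// ltW.
Qed.

Lemma feasible_slope (l2 : R) : beta * gamma / N%:R * tau^-1 < l2 ->
  beta * gamma / l2 < N%:R * tau.
Proof.
move=> feas; have l20 := feasible_pos feas.
move: feas; rewrite ltr_pdivrMr// ltr_pdivrMr// ltr_pdivrMr//.
by rewrite [N%:R * tau * l2]mulrC [N%:R * tau]mulrC mulrA.
Qed.

Lemma kullback_emp_gibbs (a l1 : R) (rho := gibbs pi (Gr a)) :
  kullback rho (emp_gibbs f pi w l1) =
  ((l1 - a) * \int[rho]_t r t - ln (Zr a) + ln (Zr l1))%:E.
Proof.
rewrite kullback_gibbs//; congr ((_ - _ + _)%:E).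
by rewrite -bmf_intZ//; apply: eq_Rintegral => t _; ring.
Qed.

(** It remains to replace the unobservable mean of [r] under [mu beta] in [gibbs_F_bound] by that
    under [sigma]. By [gibbs_risk_comparison] the error is at most [beta / l2] times a difference of
    true risks, which [Finv] bounds. *)
Lemma Bobj_valid (eps a l1 l2 : R) (rho := gibbs pi (Gr a)) :
  pair_moment beta gamma <= expR (- log_level eps N beta gamma) ->
  0 <= - log_level eps N beta gamma ->
  0 <= l1 <= gamma -> l2 <= gamma ->
  beta * gamma / N%:R * tau^-1 < l2 ->
  ((Ffun N gamma beta (\int[rho]_t Rk t - \int[mu beta]_t Rk t))%:E <=
    Bobj f pi eps w rho beta gamma l1 l2)%E.
Proof.
have aux1 (u v s k Fi lza lz1 lm ll : R) : l1 <= gamma ->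
    u <= (l1 - a) * v - lza + lz1 + lm + - ll + (gamma - l1) * (v - s) ->
    k - s <= beta / l2 * Fi ->
    u <= (l1 - a) * v - lza + lz1
         + ((gamma - l1) * (v - k) + lm - ll + (gamma - l1) * (beta / l2) * Fi).
  move=> l1g h1 h2.
  have : (gamma - l1) * (k - s) <= (gamma - l1) * (beta / l2 * Fi).
    by rewrite ler_wpM2l// subr_ge0.
  move: (beta / l2) => q; lra.
have aux2 (L y z v lz lm ell : R) : 0 < l2 -> l2 <= gamma -> l2 * z <= beta * y ->
    - (N%:R * L) - beta * y <= (l2 - l2) * v - lz + lz + lm + ell + (gamma - l2) * z ->
    - (N%:R * L) - beta * gamma / l2 * y <= lm + ell.
  move=> l20 l2g h1 h2.
  have h3 : (gamma - l2) * z <= (gamma - l2) * (beta / l2 * y).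
    rewrite ler_wpM2l ?subr_ge0//.
    by rewrite mulrAC ler_pdivlMr// mulrC.
  have h4 : (gamma - l2) * (beta / l2 * y) = beta * gamma / l2 * y - beta * y.
    by field; rewrite gt_eqF.
  lra.
move=> pm ell0 /andP[l10 l1g] l2g feas.
have l20 := feasible_pos feas.
set sigma := gibbs pi (Gr l2).
have z0 : 0 <= log_moment f w sigma sigma gamma - log_level eps N beta gamma.
  by rewrite addr_ge0// log_moment_ge0.
have Hs := gibbs_F_bound l2 l2 pm.
have Hc := gibbs_risk_comparison l2.
have y1 : tau * (\int[sigma]_t Rk t - \int[mu beta]_t Rk t) < 1.
  by apply: tau_lt1; rewrite lerBlDr (le_trans (int_le1 _))// lerDl int_ge0.
(* [gibbs_F_bound] for [sigma] itself, with [a] and [l1] both [l2]: the comparison turns the slope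
   [beta] of [Ffun] into [beta * gamma / l2], using [l2 <= gamma]. *)
have Hy := Finv_ge N0 gamma0 (feasible_slope feas) z0 y1
  (aux2 _ _ _ _ _ _ _ l20 l2g Hc Hs).
rewrite /Bobj kullback_emp_gibbs -EFinD lee_fin.
apply: (aux1 _ _ _ _ _ _ _ _ _ l1g (gibbs_F_bound a l1 pm)).
have b20 : 0 < beta / l2 by rewrite divr_gt0.
apply: le_trans (_ : _ <= beta / l2 * (\int[sigma]_t Rk t - \int[mu beta]_t Rk t)) _.
  by rewrite mulrAC ler_pdivlMr// mulrC.
by rewrite ler_pM2l.
Qed.

Lemma gibbs_risk_antimono (a b : R) : a <= b ->
  \int[gibbs pi (Gr b)]_t r t <= \int[gibbs pi (Gr a)]_t r t.
Proof.
have aux (la lb u v : R) : a < b -> la + (a - b) * v <= lb ->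
   lb + (b - a) * u <= la -> u <= v by move=> *; nra.
rewrite le_eqVlt => /predU1P[->//|ab].
have P1 := ln_partition_ge pi (bGr a) (bGr b).
have P2 := ln_partition_ge pi (bGr b) (bGr a).
apply: (aux (ln (Zr a)) (ln (Zr b)) _ _ ab).
  rewrite -(bmf_intZ _ _ br); congr (_ + _ <= _): P1.
  by apply: eq_Rintegral => t _; ring.
rewrite -(bmf_intZ _ _ br); congr (_ + _ <= _): P2.
by apply: eq_Rintegral => t _; ring.
Qed.

(** If [a <= l2], every other term of [Bobj] is nonnegative. Hence a value below the level term
    forces [l2 < a], which will supply the condition [l2 <= gamma] of [Bobj_valid]. *)
Lemma Bobj_ge (eps a l1 l2 : R) :
  0 <= - log_level eps N beta gamma ->
  0 <= l1 <= gamma -> a <= l2 ->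
  beta * gamma / N%:R * tau^-1 < l2 ->
  ((- log_level eps N beta gamma)%:E <=
    Bobj f pi eps w (gibbs pi (Gr a)) beta gamma l1 l2)%E.
Proof.
have aux (k v s lm ll q : R) : 0 <= k -> l1 <= gamma -> s <= v -> 0 <= lm -> 0 <= q ->
    - ll <= k + ((gamma - l1) * (v - s) + lm - ll + q) by move=> *; nra.
move=> ell0 /andP[l10 l1g] al2 feas.
have l20 := feasible_pos feas.
set sigma := gibbs pi (Gr l2).
have z0 : 0 <= log_moment f w sigma sigma gamma - log_level eps N beta gamma.
  by rewrite addr_ge0// log_moment_ge0.
have [F0 _ _] := FinvP (beta * gamma / l2) N0 gamma0 z0.
have K0 := kullback_gibbs_ge0 pi (bGr a) (bGr l1).
move: K0; rewrite /Bobj kullback_emp_gibbs -EFinD !lee_fin => K0.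
have g0 : 0 <= gamma - l1 by rewrite subr_ge0.
have q0 : 0 <= beta / l2 by rewrite divr_ge0// ltW.
have lm0 := log_moment_ge0 (emp_gibbs f pi w l1) (gibbs pi (Gr a)).
exact: (aux _ _ _ _ _ _ K0 l1g (gibbs_risk_antimono al2) lm0
         (mulr_ge0 (mulr_ge0 g0 q0) F0)).
Qed.

(** * Consequences of a nonpositive bound *)

Section negative_bound.
Variable eps : R.
Hypothesis ell0 : 0 < - log_level eps N beta gamma.
Hypothesis B0 : (Bfun f pi eps w (gibbs pi (Gr (gamma / 2))) beta gamma <= 0)%E.

(** The infimum need not be attained, so near minimizers are used; taking them also below the level
    term rules out [gamma / 2 <= l2]. *)
Let Bobj_small (del : R) : 0 < del -> exists l1 l2 : R,
  [/\ 0 <= l1 <= gamma, l2 < gamma / 2, beta * gamma / N%:R * tau^-1 < l2 &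
   (Bobj f pi eps w (gibbs pi (Gr (gamma / 2)%R)) beta gamma l1 l2 < del%:E)%E].
Proof.
move=> del0; set e := Num.min del (- log_level eps N beta gamma).
have : (Bfun f pi eps w (gibbs pi (Gr (gamma / 2)%R)) beta gamma < e%:E)%E.
  by apply: le_lt_trans B0 _; rewrite lte_fin lt_min del0 ell0.
move=> /ereal_inf_lt[_ [[l1 l2] /= [l1g feas] <-] lte].
exists l1, l2; split => //.
  rewrite ltNge; apply/negP => le2.
  have := Bobj_ge (ltW ell0) l1g le2 feas; rewrite leNgt (lt_le_trans lte)//.
  by rewrite lee_fin ge_min lexx orbT.
by apply: lt_le_trans lte _; rewrite lee_fin ge_min lexx.
Qed.

(** Feasibility with [l2 < gamma / 2] gives [2 * beta < N%:R * tau], and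
    [N%:R * tau <= 2 * gamma]. *)
Lemma Bfun_le0_lt : beta < gamma.
Proof.
have [l1 [l2 [_ h1 h2 _]]] := Bobj_small ltr01.
have : beta * gamma / N%:R * tau^-1 < gamma / 2 by exact: lt_trans h1.
rewrite ltr_pdivrMr// ltr_pdivrMr// => h.
have ht : tau * N%:R <= 2 * gamma.
  rewrite -ler_pdivlMr//; apply: le_trans (tanh_le _) _; last by rewrite mulrA.
  by rewrite divr_ge0// ltW.
have : gamma / 2 * tau * N%:R <= gamma * gamma.
  rewrite -mulrA; have : gamma / 2 * (tau * N%:R) <= gamma / 2 * (2 * gamma).
    by rewrite ler_pM2l// divr_gt0.
  by move: (tau * _) => q; lra.
by move/(lt_le_trans h); rewrite ltr_pM2r.
Qed.

(** By [Bobj_valid], [Ffun] at the risk difference is below every positive number, and [Ffun_lower]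
    bounds it below by a positive multiple of that difference. *)
Lemma Bfun_le0_risk :
  pair_moment beta gamma <= expR (- log_level eps N beta gamma) ->
  \int[gibbs pi (Gr (gamma / 2))]_t Rk t <= \int[mu beta]_t Rk t.
Proof.
have aux (u v : R) (q : R) : 0 < q -> q * (u - v) <= 0 -> u <= v by move=> *; nra.
move=> pm.
have Nb : 0 < N%:R * tau - beta.
  have [l1 [l2 [_ h1 h2 _]]] := Bobj_small ltr01.
  have hg : gamma / 2 < gamma by rewrite gtr_pMr// invf_lt1 ?ltr1n.
  have := lt_trans (lt_trans h2 h1) hg.
  rewrite ltr_pdivrMr// ltr_pdivrMr// -mulrA mulrC ltr_pM2l// => h.
  by rewrite subr_gt0 mulrC.
apply: (aux _ _ _ Nb).
have x1 : tau * (\int[gibbs pi (Gr (gamma / 2))]_t Rk t - \int[mu beta]_t Rk t) < 1.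
  by apply: tau_lt1; rewrite lerBlDr (le_trans (int_le1 _))// lerDl int_ge0.
apply: (le_trans (Ffun_lower beta N0 x1)).
apply/ler_addgt0Pr => del del0; rewrite add0r.
have [l1 [l2 [h0 h1 h2 h3]]] := Bobj_small del0.
rewrite -lee_fin; apply: le_trans (ltW h3).
apply: Bobj_valid => //; first exact: ltW.
by rewrite (le_trans (ltW h1))// ler_piMr ?ltW// invf_lt1 ?ltr1n.
Qed.

End negative_bound.

(** * A sufficient condition for a nonpositive bound *)

Section upper_bound.
Variable t0 : Theta.

Local Notation Zc a := (partition pi (fun t => - (a * (r t - r t0)))).
Local Notation Yc a := (partition pi (fun t => - (a * (r t - r t0)) + lc * m' t t0)).
Local Notation ZRc b := (partition pi (fun t => - (b * (Rk t - Rk t0)))).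

Let bm0 : bmf (fun t => m' t t0).
Proof. exact: bm1. Qed.

Let ln_Zc (a : R) : ln (Zc a) = ln (Zr a) + a * r t0.
Proof.
rewrite -(ln_partition_shift pi _ (bGr a)); congr ln; apply: eq_Rintegral => t _; congr expR; ring.
Qed.

Let bY (a : R) : bmf (fun t => Gr a t + lc * m' t t0).
Proof. exact: bmfD (bGr a) (bmfZ lc bm0). Qed.

Let ln_Yc (a : R) :
  ln (Yc a) = ln (partition pi (fun t => Gr a t + lc * m' t t0)) + a * r t0.
Proof.
rewrite -(ln_partition_shift pi _ (bY a)); congr ln; apply: eq_Rintegral => t _; congr expR; ring.
Qed.

Lemma gibbs_risk_gap (a b : R) :
  ln (Zc a) - ln (Zc b) <= (b - a) * (\int[gibbs pi (Gr a)]_t r t - r t0).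
Proof. exact: ln_partition_gap. Qed.

Lemma emp_dist_triangle t t' : m' t t' <= m' t t0 + m' t' t0.
Proof.
rewrite /emp_dist -mulrDr -big_split/=.
apply: ler_wpM2l; first by rewrite invr_ge0.
apply: ler_sum => i _; rewrite [`|(f t' _ != _)%:R - _|]distrC.
exact: ler_distD.
Qed.

(** The triangle inequality through [t0] splits the double integral of [m'] into two parts; Jensen's
    inequality bounds the inner one by the outer one, whence the factor 2. *)
Lemma log_moment_self_le (a : R) (nu := gibbs pi (Gr a)) :
  log_moment f w nu nu gamma <= 2 * (ln (Yc a) - ln (Zc a)).
Proof.
have lc0 : 0 <= lc by rewrite mulr_ge0// ln_cosh_ge0.
have bl := bmfZ lc bm0.
have E1 : ln (\int[nu]_t expR (lc * m' t t0)) = ln (Yc a) - ln (Zc a).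
  rewrite (ln_Yc a) (ln_Zc a) opprD addrACA subrr addr0 -ln_div ?posrE ?partition_gt0//.
  congr ln.
  exact: (gibbs_int_expR pi (bGr a) bl).
have J := jensen_ln nu bl; rewrite E1 in J.
have bs := bmfD bl (bmf_cst (\int[nu]_t (lc * m' t t0))).
have h1 : log_moment f w nu nu gamma <=
    ln (\int[nu]_t expR (lc * m' t t0 + \int[nu]_t (lc * m' t t0))).
  rewrite /log_moment ler_ln ?posrE; first last.
  - exact: int_expR_gt0.
  - by apply: int_expR_gt0; exact: bmfZ.
  - apply: bmf_le_int; [exact: bmf_expR (bmfZ lc (bmi nu))|exact: bmf_expR|].
    move=> t; rewrite ler_expR (bmf_intZ _ _ bm0) -mulrDr; apply: ler_wpM2l => //.
    apply: (@le_trans _ _ (\int[nu]_t' (m' t t0 + m' t' t0))).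
      apply: bmf_le_int => //; first exact: bmfD (bmf_cst _) bm0.
      by move=> t'; exact: emp_dist_triangle.
    by rewrite (bmf_intD _ (bmf_cst _) bm0) prob_int_cst.
have h2 := ln_partition_shift nu (\int[nu]_t (lc * m' t t0)) bl.
rewrite /partition E1 in h2.
apply: (le_trans h1); rewrite h2 mulrDl mul1r; exact: lerD.
Qed.

(** Evaluates [Bobj] at [l1 = gamma / 2], where the Kullback divergence vanishes, and at
    [l2 = 4 * beta]. The hypotheses with a single [S] compare empirical partition functions with
    those of the risk; the next four measure how the latter vary. *)
Lemma Bfun_le0_sufficient (eps A S d rem : R) (l2 := 4 * beta) :
  1 < A -> gamma <= N%:R ->
  0 <= - log_level eps N beta gamma ->
  ln (Zc (A * l2)) <= S + ln (ZRc (A * l2 / 2)) ->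
  ln (Zc (gamma / 4)) <= S + ln (ZRc (gamma / 8)) ->
  ln (Yc (gamma / 2)) <= S + ln (ZRc (gamma / 4)) ->
  ln (Yc l2) <= S + rem + ln (ZRc (l2 / 2)) ->
  ln (ZRc (2 * l2)) <= S + ln (Zc l2) ->
  ln (ZRc gamma) <= S + ln (Zc (gamma / 2)) ->
  2 * S + 1 <= ln (ZRc (2 * l2)) - ln (ZRc (A * l2 / 2)) ->
  ln (ZRc (gamma / 8)) - ln (ZRc gamma) <= 6 * d ->
  ln (ZRc (gamma / 4)) - ln (ZRc gamma) <= 4 * d ->
  ln (ZRc (l2 / 2)) - ln (ZRc (2 * l2)) <= 4 * d ->
  24 * d + 10 * S + rem + 3 / 2 * - log_level eps N beta gamma
    <= gamma / (2 * A * l2) ->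
  (Bfun f pi eps w (gibbs pi (Gr (gamma / 2))) beta gamma <= 0)%E.
Proof.
(* Between [l2] and [A * l2] the logarithm of [Zc] drops by at least 1, so the mean excess [s - v]
   at [l2] is at least [1 / (A * l2)]. *)
have aux0 (p q zl za s v : R) : 1 < A -> 2 * S + 1 <= p - q ->
    za <= S + q -> p <= S + zl -> zl - za <= (A * l2 - l2) * (s - v) ->
    gamma / (2 * A * l2) <= gamma / 2 * (s - v).
  move=> A1 h1 h2 h3 h4.
  have l20 : 0 < l2 by rewrite mulr_gt0.
  have sv : 1 <= A * l2 * (s - v).
    have : 1 <= (A - 1) * l2 * (s - v) by rewrite mulrBl mul1r; lra.
    have : 0 < (A - 1) * l2 by rewrite mulr_gt0// subr_gt0.
    by move: l20 A1; move: (s - v) => x *; nra.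
  have -> : gamma / (2 * A * l2) = gamma / 2 * (A * l2)^-1.
    by field; rewrite !gt_eqF//; lra.
  rewrite ler_pM2l ?divr_gt0// -div1r ler_pdivrMr; first by rewrite mulrC.
  by apply: mulr_gt0 => //; lra.
(* The excess at [gamma / 2] costs [12 * d + 4 * S], the first log moment [8 * d + 4 * S], the
   [Finv] term [4 * d + 2 * S + rem + ell / 2], and the level [ell]. *)
have aux (x8 x4 xg z4 zl y2 yl p2 p5 z2 zr u s v lr ls Fi ell gl : R) :
    z4 <= S + x8 -> y2 <= S + x4 -> yl <= S + rem + p5 -> p2 <= S + zl ->
    xg <= S + z2 -> x8 - xg <= 6 * d -> x4 - xg <= 4 * d -> p5 - p2 <= 4 * d ->
    24 * d + 10 * S + rem + 3 / 2 * ell <= gl ->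
    gl <= gamma / 2 * (s - v) ->
    z2 - z4 <= (gamma / 4 - gamma / 2) * (u - v) ->
    lr <= 2 * (y2 - z2) -> ls <= 2 * (yl - zl) ->
    gamma / 4 * Fi <= ls + ell ->
    (gamma / 2 - gamma / 2) * u - zr + zr + ((gamma - gamma / 2) * (u - s) + lr + ell
      + (gamma - gamma / 2) * (beta / l2) * Fi) <= 0.
  have -> : beta / l2 = 1 / 4 by rewrite /l2; field; rewrite gt_eqF.
  by move=> *; lra.
have auxF (q : R) : gamma / 2 <= N%:R * q -> beta * gamma < l2 * q * N%:R.
  have h : 0 < beta * gamma by rewrite mulr_gt0.
  rewrite -(ler_pM2l beta0) /l2; lra.
have auxG (x y : R) : gamma / 2 <= x -> y = gamma / 4 -> gamma / 4 <= x - y.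
  by move=> *; lra.
move=> A1 gN ell0 U1 U2 M1 M2 L1 L2 D1 D2 D3 D4 fin.
have tg : gamma / 2 <= N%:R * tau.
  have := @tanh_ge _ (gamma / N%:R).
  rewrite divr_ge0 ?(ltW gamma0)//= ler_pdivrMr// mul1r gN => /(_ isT).
  rewrite -(ler_pM2l NR0); congr (_ <= _); field.
  by rewrite gt_eqF.
have b40 : 0 < l2 by rewrite mulr_gt0.
have feas : beta * gamma / N%:R * tau^-1 < l2.
  rewrite ltr_pdivrMr// ltr_pdivrMr//.
  exact: auxF.
set sigma := gibbs pi (Gr l2).
have lms0 := log_moment_ge0 sigma sigma.
have z0 := addr_ge0 lms0 ell0.
(* With [l2 = 4 * beta] the parameter of [Finv] is [gamma / 4], half of the lower bound [gamma / 2]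
   on [N%:R * tau], so the slope in [Finv_le] is at least [gamma / 4]. *)
have alE : beta * gamma / l2 = gamma / 4 by rewrite /l2; field; rewrite gt_eqF.
have FiE : gamma / 4 * Finv N gamma (beta * gamma / l2)
      (log_moment f w sigma sigma gamma - log_level eps N beta gamma) <=
    log_moment f w sigma sigma gamma + - log_level eps N beta gamma.
  have [F0 _ _] := FinvP (beta * gamma / l2) N0 gamma0 z0.
  apply: le_trans (Finv_le (beta * gamma / l2) N0 gamma0 z0).
  exact: (ler_wpM2r F0 (auxG _ _ tg alE)).
have gap1 := gibbs_risk_gap (gamma / 2) (gamma / 4).
have gap2 := aux0 _ _ _ _ _ _ A1 D1 U1 L1 (gibbs_risk_gap l2 (A * l2)).
have lmr := log_moment_self_le (gamma / 2).
have lms := log_moment_self_le l2.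
apply: (@le_trans _ _ (Bobj f pi eps w (gibbs pi (Gr (gamma / 2)%R)) beta gamma (gamma / 2)%R l2)).
  apply: ereal_inf_lbound; exists ((gamma / 2)%R, l2) => //=; split=> //.
  by rewrite divr_ge0 ?(ltW gamma0)// ler_piMr ?(ltW gamma0)// invf_le1 ?ler1n.
rewrite /Bobj kullback_emp_gibbs -EFinD lee_fin.
exact: (aux _ _ _ _ _ _ _ _ _ _ _ _ _ _ _ _ _ _ _
  U2 M1 M2 L1 L2 D2 D3 D4 fin gap2 gap1 lmr lms FiE).
Qed.

End upper_bound.

End one_pair.
End empirical_bound.

(** * Exponential moments and the good event *)

Section expectations.
Variables (N : nat) (PP : probability (N.-tuple (X * Y)) R).
Variable P : 'I_N -> probability (X * Y)%type R.
Hypotheses (prodPP : is_product_measure PP P) (N0 : (0 < N)%N).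

Local Notation W := (N.-tuple (X * Y)).
Local Notation Rk := (risk f PP).

Let NR0 : 0 < N%:R :> R.
Proof. by rewrite ltr0n. Qed.

Let bRk : bmf Rk.
Proof. exact: (bmf_risk prodPP). Qed.

Let Rk01 t : 0 <= Rk t <= 1.
Proof. exact: (risk_itv prodPP). Qed.

Lemma pair_exponent_moment (gamma : R) (t t' : Theta) : 0 < gamma ->
  \int[PP]_w expR (pair_exponent Rk gamma w t t') <= 1.
Proof.
move=> gamma0; rewrite /pair_exponent; set a := gamma / N%:R.
set y := 1 - tanh a * (Rk t - Rk t').
have y0 : 0 < y.
  rewrite subr_gt0; apply: tanh_mul_lt1 => //.
  have /andP[p0 p1] := Rk01 t; have /andP[q0 q1] := Rk01 t'; lra.
have yn : y != 0 by rewrite gt_eqF.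
have eln : expR (- ln y) = y^-1 by rewrite expRN lnK.
(* The exponentials equal [(1 - tanh a) / y] and [(1 + tanh a) / y], so [b] can be 0, and the choice
   of [y] makes the resulting exponent vanish. *)
apply: (le_trans (@moment_bound _ _ _ prodPP t t' (- ln y) (- a) (- ln (cosh a))
    y^-1 (- (tanh a / y)) 0 N0 _ _ _ _)) => //.
- by rewrite eln.
- by rewrite -addrA expRD eln expRN_ln_cosh le_eqVlt; apply/orP; left; apply/eqP; field.
- rewrite opprK -addrA expRD eln expR_ln_cosh le_eqVlt; apply/orP; left; apply/eqP; field.
  exact: yn.
rewrite mul0r addr0 -[leRHS]expR0 ler_expR le_eqVlt; apply/orP; left; apply/eqP.
have -> : y^-1 - 1 + - (tanh a / y) * (Rk t - Rk t') = 0.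
  have -> : y^-1 - 1 + - (tanh a / y) * (Rk t - Rk t') =
      (1 - (y + tanh a * (Rk t - Rk t'))) / y by field.
  by rewrite /y subrK subrr mul0r.
by rewrite mulr0.
Qed.

Section pair_moment.
Variables (beta gamma : R).
Hypothesis gamma0 : 0 < gamma.

Let mu := gibbs pi (fun t => - (beta * Rk t)).

Let b3 : bmf (fun s : W * Theta * Theta =>
  expR (pair_exponent Rk gamma s.1.1 s.2 s.1.2)).
Proof.
apply: bmf_expR; apply: (bmf_pair_exponent N0 bRk Rk01 gamma0) => //.
- exact: measurableT_comp.
- exact: measurableT_comp.
Qed.

Let b2 : bmf (fun s : W * Theta =>
  \int[mu]_t expR (pair_exponent Rk gamma s.1 t s.2)).
Proof. exact: (bmf_int2 (PP \x mu)%E mu b3). Qed.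

Lemma bmf_pair_moment : bmf (fun w : W => pair_moment w Rk beta gamma).
Proof. exact: (bmf_int2 PP mu b2). Qed.

(** The measure [mu] depends only on the true risk, hence not on the sample, and Fubini brings the
    sample integral inside. *)
Lemma pair_moment_expectation : \int[PP]_w pair_moment w Rk beta gamma <= 1.
Proof.
rewrite [leLHS](bmf_fubini PP mu b2).
apply: bmf_le_int_cst; first exact: (bmf_int1 PP mu b2).
move=> t'.
have bt : bmf (fun s : W * Theta => expR (pair_exponent Rk gamma s.1 s.2 t')).
  apply: bmf_expR; apply: (bmf_pair_exponent N0 bRk Rk01 gamma0) => //.
rewrite [leLHS](bmf_fubini PP mu bt).
apply: bmf_le_int_cst; first exact: (bmf_int1 PP mu bt).
by move=> t; exact: pair_exponent_moment.
Qed.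

End pair_moment.

(* Unlike [pair_moment], only the comparison with a fixed [t0] is needed here,
   at the price of a second order term controlled by the disagreement. *)
Lemma prior_moment (t0 : Theta) (h k : Theta -> R) (a x1 x2 : R) :
  bmf h -> bmf k -> 0 <= a <= 1 / 2 -> `|x1| <= a -> 0 <= x2 <= 2 * a ^+ 2 ->
  (forall t, h t + N%:R * (x1 * (Rk t - Rk t0))
     + N%:R * (10 * a ^+ 2 * disagreement f PP t t0) <= k t) ->
  let V (w : W) := \int[pi]_t expR (h t + N%:R *
       (x1 * (emp_risk R f w t - emp_risk R f w t0) + x2 * emp_dist R f w t t0)) in
  bmf V /\ \int[PP]_w V w <= partition pi k.
Proof.
move=> bh bk /andP[a0 a2]; rewrite ler_norml => /andP[x1a x1a'] /andP[x20 x2a] hk V.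
have b : bmf (fun s : W * Theta => expR (h s.2 + N%:R *
       (x1 * (emp_risk R f s.1 s.2 - emp_risk R f s.1 t0) + x2 * emp_dist R f s.1 s.2 t0))).
  apply: bmf_expR; apply: bmfD; first exact: bmf_comp.
  apply: bmfZ; apply: bmfD; last by apply: bmfZ; exact: bmf_emp_dist.
  by apply: bmfZ; apply: bmfB; exact: bmf_emp_risk.
split; first exact: (bmf_int2 PP pi b).
rewrite [leLHS](bmf_fubini PP pi b).
apply: bmf_le_int; [exact: (bmf_int1 PP pi b)|exact: bmf_expR|move=> t /=].
have bt : bmf (fun w : W => expR (N%:R * (0 +
       x1 * (emp_risk R f w t - emp_risk R f w t0) + x2 * emp_dist R f w t t0))).
  apply: bmf_expR; apply: bmfZ; apply: bmfD; last by apply: bmfZ; exact: bmf_emp_dist.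
  apply: bmfD; first exact: bmf_cst.
  by apply: bmfZ; apply: bmfB; exact: bmf_emp_risk.
have a21 : a ^+ 2 <= a / 2 by rewrite expr2; nra.
(* From [expR_le_quadratic]: [x2 <= 2 * a ^+ 2] and twice [(x1 + x2) ^+ 2 <= 4 * a ^+ 2] add up to
   [10 * a ^+ 2]. *)
have q1 : expR (x1 + x2) <= 1 + x1 + 10 * a ^+ 2.
  apply: le_trans (expR_le_quadratic _) _; first by rewrite ler_norml; lra.
  have : (x1 + x2) ^+ 2 <= (2 * a) ^+ 2.
    by rewrite -[leLHS]real_normK ?num_real// lerXn2r ?nnegrE ?ler_norml//; lra.
  rewrite exprMn; lra.
have q2 : expR (- x1 + x2) <= 1 - x1 + 10 * a ^+ 2.
  apply: le_trans (expR_le_quadratic _) _; first by rewrite ler_norml; lra.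
  have : (- x1 + x2) ^+ 2 <= (2 * a) ^+ 2.
    by rewrite -[leLHS]real_normK ?num_real// lerXn2r ?nnegrE ?ler_norml//; lra.
  rewrite exprMn; lra.
have mb : \int[PP]_w expR (N%:R * (0 + x1 * (emp_risk R f w t - emp_risk R f w t0)
      + x2 * emp_dist R f w t t0)) <=
    expR (N%:R * (1 - 1 + x1 * (Rk t - Rk t0) + 10 * a ^+ 2 * disagreement f PP t t0)).
  apply: (moment_bound prodPP) => //; first by apply: mulr_ge0 => //; exact: sqr_ge0.
  - by rewrite add0r.
  - by rewrite add0r.
have -> : \int[PP]_w expR (h t + N%:R *
       (x1 * (emp_risk R f w t - emp_risk R f w t0) + x2 * emp_dist R f w t t0)) =
    expR (h t) * \int[PP]_w expR (N%:R * (0 +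
       x1 * (emp_risk R f w t - emp_risk R f w t0) + x2 * emp_dist R f w t t0)).
  rewrite -(bmf_intZ _ _ bt); apply: eq_Rintegral => w _.
  by rewrite -expRD add0r.
apply: (@le_trans _ _ (expR (h t) * expR (N%:R * (1 - 1 + x1 * (Rk t - Rk t0)
    + 10 * a ^+ 2 * disagreement f PP t t0)))).
  by rewrite ler_wpM2l// expR_ge0.
by rewrite -expRD ler_expR subrr add0r mulrDr addrA; exact: hk.
Qed.

End expectations.

(** * Comparison of empirical and true partition functions *)

Section controls.
Variables (N : nat) (PP : probability (N.-tuple (X * Y)) R).
Variable P : 'I_N -> probability (X * Y)%type R.
Hypotheses (prodPP : is_product_measure PP P) (N0 : (0 < N)%N).
Variable t0 : Theta.

Local Notation W := (N.-tuple (X * Y)).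
Local Notation Rk := (risk f PP).
Local Notation ZRc b := (partition pi (fun t => - (b * (Rk t - Rk t0)))).

Let bRk : bmf Rk.
Proof. exact: (bmf_risk prodPP). Qed.

Let bRc (b : R) : bmf (fun t => - (b * (Rk t - Rk t0))).
Proof. by apply: bmfN; apply: bmfZ; apply: bmfB => //; exact: bmf_cst. Qed.

(** Recasts a moment bound as a nonnegative [u] of mean at most 1, so that several of them can share
    one use of Markov's inequality. *)
Let normalized (h k : Theta -> R) (a x1 x2 : R) :
  bmf h -> bmf k -> 0 <= a <= 1 / 2 -> `|x1| <= a -> 0 <= x2 <= 2 * a ^+ 2 ->
  (forall t, h t + N%:R * (x1 * (Rk t - Rk t0))
     + N%:R * (10 * a ^+ 2 * disagreement f PP t t0) <= k t) ->
  exists u : W -> R, [/\ bmf u, forall w, 0 <= u w, \int[PP]_w u w <= 1 &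
    forall w K, 0 < K -> u w <= K ->
    ln (\int[pi]_t expR (h t + N%:R *
       (x1 * (emp_risk R f w t - emp_risk R f w t0) + x2 * emp_dist R f w t t0)))
    <= ln K + ln (partition pi k)].
Proof.
move=> bh bk a12 x1a x2a hk.
have [bV VE] := prior_moment prodPP N0 bh bk a12 x1a x2a hk.
have k0 := partition_gt0 pi bk.
have ik0 : 0 < (partition pi k)^-1 by rewrite invr_gt0.
set V := (fun w : W => \int[pi]_t _) in bV VE.
have bI w : bmf (fun t => h t + N%:R *
       (x1 * (emp_risk R f w t - emp_risk R f w t0) + x2 * emp_dist R f w t t0)).
  apply: bmfD => //; apply: bmfZ; apply: bmfD; apply: bmfZ.
    by apply: bmfB; [exact: (@bmf_emp_risk _ _ _ (fun=> w) id)|exact: bmf_cst].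
  exact: (@bmf_emp_dist _ _ _ (fun=> w) id (fun=> t0)).
have V0 w : 0 < V w by exact: int_expR_gt0.
exists (fun w => (partition pi k)^-1 * V w); split.
- exact: bmfZ.
- move=> w; exact: mulr_ge0 (ltW ik0) (ltW (V0 w)).
- have E := bmf_intZ PP (partition pi k)^-1 bV.
  have le1 : (partition pi k)^-1 * \int[PP]_w V w <= 1.
    by apply: (le_trans (ler_wpM2l (ltW ik0) VE)); rewrite mulVf// gt_eqF.
  rewrite -E in le1; exact: le1.
- move=> w K K0 VK; rewrite -lnM ?posrE// ler_ln ?posrE; [|exact: V0|exact: mulr_gt0].
  by rewrite -ler_pdivrMr// mulrC.
Qed.

(** Half of the temperature [lam] is spent on absorbing the second order term, which leaves
    [lam / 2] in [ZRc]. *)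
Lemma upper_control (lam g a rem : R) : 0 <= a <= 1 / 2 -> 0 <= lam <= N%:R * a ->
  0 <= g <= N%:R * (2 * a ^+ 2) ->
  (forall t, N%:R * (10 * a ^+ 2 * disagreement f PP t t0) <=
     lam / 2 * (Rk t - Rk t0) + rem) ->
  exists u : W -> R, [/\ bmf u, forall w, 0 <= u w, \int[PP]_w u w <= 1 &
    forall w K, 0 < K -> u w <= K ->
    ln (partition pi (fun t => - (lam * (emp_risk R f w t - emp_risk R f w t0))
       + g * emp_dist R f w t t0)) <= ln K + rem + ln (ZRc (lam / 2))].
Proof.
have aux (v l s p : R) : v <= l + s -> s = p + rem -> v <= l + rem + p.
  by move=> *; lra.
move=> a12 /andP[l0 la] /andP[g0 ga] hD.
have NR0 : 0 < N%:R :> R by rewrite ltr0n.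
have [||t|u [bu u0 u1 uK]] := @normalized (fun=> 0)
    (fun t => - (lam / 2 * (Rk t - Rk t0)) + rem) a (- (lam / N%:R)) (g / N%:R)
    (bmf_cst _) (bmfD (bRc _) (bmf_cst _)) a12.
- by rewrite normrN ger0_norm ?divr_ge0 ?(ltW NR0)// ler_pdivrMr// mulrC.
- by rewrite divr_ge0 ?(ltW NR0)//= ler_pdivrMr// mulrC.
- have -> : N%:R * (- (lam / N%:R) * (Rk t - Rk t0)) = - (lam * (Rk t - Rk t0)).
    by field; rewrite gt_eqF.
  by have := hD t; lra.
exists u; split; [exact: bu|exact: u0|exact: u1|move=> w K K0 uwK].
have P0 := uK w K K0 uwK.
have Pr := ln_partition_shift pi rem (bRc (lam / 2)).
have E : partition pi (fun t => - (lam * (emp_risk R f w t - emp_risk R f w t0))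
       + g * emp_dist R f w t t0) = \int[pi]_t expR (0 + N%:R * (- (lam / N%:R) *
    (emp_risk R f w t - emp_risk R f w t0) + g / N%:R * emp_dist R f w t t0)).
  by apply: eq_Rintegral => t _; congr expR; field; rewrite gt_eqF.
rewrite E; exact: (aux _ _ _ _ P0 Pr).
Qed.

(** Moments only bound partition functions from above. The energy [2 * lam * R] is the midpoint of
    [4 * lam * R - lam * r] and [lam * r], so convexity of the log partition function turns an upper
    bound at the former into a lower bound at the latter. *)
Lemma lower_control (lam a rem : R) : 0 <= a <= 1 / 2 -> 0 <= lam <= N%:R * a ->
  (forall t, N%:R * (10 * a ^+ 2 * disagreement f PP t t0) <=
     lam / 2 * (Rk t - Rk t0) + rem) ->
  (forall t, Rk t0 <= Rk t) ->
  exists u : W -> R, [/\ bmf u, forall w, 0 <= u w, \int[PP]_w u w <= 1 &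
    forall w K, 0 < K -> u w <= K ->
    ln (ZRc (2 * lam)) <= ln K + rem
      + ln (partition pi (fun t => - (lam * (emp_risk R f w t - emp_risk R f w t0))))].
Proof.
have aux (p i q v l s : R) : p + i <= q -> p + - i <= v -> v <= l + s ->
    s = p + rem -> p <= l + rem + q by move=> *; lra.
move=> a12 /andP[l0 la] hD hR.
have NR0 : 0 < N%:R :> R by rewrite ltr0n.
have [||t|u [bu u0 u1 uK]] := @normalized (fun t => - (4 * lam * (Rk t - Rk t0)))
    (fun t => - (2 * lam * (Rk t - Rk t0)) + rem) a (lam / N%:R) 0
    (bRc _) (bmfD (bRc _) (bmf_cst _)) a12.
- by rewrite ger0_norm ?divr_ge0 ?(ltW NR0)// ler_pdivrMr// mulrC.
- by rewrite lexx/= mulr_ge0// sqr_ge0.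
- have -> : N%:R * (lam / N%:R * (Rk t - Rk t0)) = lam * (Rk t - Rk t0).
    by field; rewrite gt_eqF.
  have : 0 <= lam * (Rk t - Rk t0) by rewrite mulr_ge0// subr_ge0.
  by have := hD t; lra.
exists u; split; [exact: bu|exact: u0|exact: u1|move=> w K K0 uwK].
have P0 := uK w K K0 uwK.
have Pr := ln_partition_shift pi rem (bRc (2 * lam)).
have br : bmf (fun t => lam * (emp_risk R f w t - emp_risk R f w t0)).
  by apply: bmfZ; apply: bmfB; [exact: (@bmf_emp_risk _ _ _ (fun=> w) id)|exact: bmf_cst].
have b4 := bRc (4 * lam); have b2 := bRc (2 * lam).
have P1 := ln_partition_ge pi b2 (bmfN br).
have P2 := ln_partition_ge pi b2 (bmfD b4 br).
have bs := bmfB (bmfN br) b2.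
have E : \int[gibbs pi (fun t => - (2 * lam * (Rk t - Rk t0)))]_t
     (- (4 * lam * (Rk t - Rk t0)) + lam * (emp_risk R f w t - emp_risk R f w t0)
       - - (2 * lam * (Rk t - Rk t0))) =
   - \int[gibbs pi (fun t => - (2 * lam * (Rk t - Rk t0)))]_t
     (- (lam * (emp_risk R f w t - emp_risk R f w t0)) - - (2 * lam * (Rk t - Rk t0))).
  by rewrite -(bmf_intN _ bs); apply: eq_Rintegral => t _; ring.
rewrite E in P2.
have E' : partition pi (fun t => - (4 * lam * (Rk t - Rk t0)) +
      lam * (emp_risk R f w t - emp_risk R f w t0)) =
    \int[pi]_t expR (- (4 * lam * (Rk t - Rk t0)) + N%:R *
      (lam / N%:R * (emp_risk R f w t - emp_risk R f w t0) + 0 * emp_dist R f w t t0)).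
  by apply: eq_Rintegral => t _; congr expR; field; rewrite gt_eqF.
rewrite -E' in P0; exact: (aux _ _ _ _ _ _ P1 P2 P0 Pr).
Qed.

End controls.

(** * The event of probability at least 1 - eps *)

Section good_event.
Variables (N : nat) (PP : probability (N.-tuple (X * Y)) R).
Variable P : 'I_N -> probability (X * Y)%type R.
Hypotheses (prodPP : is_product_measure PP P) (N1 : (1 < N)%N).
Variables (t0 : Theta) (eps c kappa : R).
Hypotheses (eps01 : 0 < eps < 1) (c0 : 0 < c) (kappa1 : 1 < kappa).

Local Notation W := (N.-tuple (X * Y)).
Local Notation Rk := (risk f PP).
Local Notation e := ((kappa - 1)^-1).
Local Notation K := (up_log 2 N).

Hypothesis t0_min : forall t, Rk t0 <= Rk t.
Hypothesis margin : forall t,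
  c * disagreement f PP t t0 `^ kappa <= Rk t - Rk t0.

Let N0 : (0 < N)%N.
Proof. exact: ltnW. Qed.

Let NR0 : 0 < N%:R :> R.
Proof. by rewrite ltr0n. Qed.

Let bRk : bmf Rk.
Proof. exact: (bmf_risk prodPP). Qed.

Lemma pair_moment_ge0 (w : W) (beta gamma : R) : 0 <= pair_moment w Rk beta gamma.
Proof.
by apply: Rintegral_ge0 => t' _; apply: Rintegral_ge0 => t _; exact: expR_ge0.
Qed.

Let margin_control (a lam : R) : 0 < lam -> forall t,
  N%:R * (10 * a ^+ 2 * disagreement f PP t t0) <= lam / 2 * (Rk t - Rk t0)
    + N%:R * (10 * a ^+ 2) * (N%:R * (10 * a ^+ 2) / (lam / 2 * c)) `^ e.
Proof.
move=> lam0 t; rewrite mulrA; apply: margin_young => //.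
- by rewrite mulr_ge0 ?(ltW NR0)// mulr_ge0// sqr_ge0.
- exact: divr_gt0.
- by rewrite mulr_ge0 ?invr_ge0// sumr_ge0// => i _; rewrite fine_ge0.
Qed.

Variables (beta gamma : R).
Hypotheses (beta0 : 0 < beta) (bg : 16 * beta <= gamma) (gammaN : gamma <= N%:R / 2).

Local Notation C := (10 * (40 / c) `^ e).
Local Notation rem :=
  (10 * gamma ^+ 2 / N%:R * (20 * gamma ^+ 2 / (N%:R * (4 * beta) * c)) `^ e).
Hypothesis remC :
  10 * gamma ^+ 2 / N%:R * (40 * gamma / (N%:R * c)) `^ e <= C.

Let gamma0 : 0 < gamma.
Proof. by apply: lt_le_trans bg; rewrite mulr_gt0. Qed.

Let C0 : 0 <= C.
Proof. by rewrite mulr_ge0 ?powR_ge0. Qed.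

(** When the scale of the deviation matches the temperature, the remainder increases with [lam] and
    is controlled at gamma by [remC]. *)
Let small_control (lam : R) : 0 < lam -> lam <= gamma -> forall t,
  N%:R * (10 * (lam / N%:R) ^+ 2 * disagreement f PP t t0)
    <= lam / 2 * (Rk t - Rk t0) + C.
Proof.
move=> lam0 lg t; apply: le_trans (margin_control _ lam0 t) _.
rewrite lerD2l; apply: le_trans remC.
have nn : N%:R != 0 :> R by rewrite gt_eqF.
have cn : c != 0 by rewrite gt_eqF.
have ln : lam != 0 by rewrite gt_eqF.
have -> : N%:R * (10 * (lam / N%:R) ^+ 2) = 10 * lam ^+ 2 / N%:R by field.
have -> : 10 * lam ^+ 2 / N%:R / (lam / 2 * c) = 20 * lam / (N%:R * c).
  by field; rewrite ln nn cn.
apply: ler_pM; rewrite ?powR_ge0//.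
- by rewrite divr_ge0 ?(ltW NR0)// mulr_ge0// sqr_ge0.
- rewrite ler_pM2r ?invr_gt0// ler_pM2l//.
  by rewrite lerXn2r ?nnegrE ?(ltW lam0) ?(ltW gamma0).
apply: ge0_ler_powR; rewrite ?nnegrE.
- by rewrite invr_ge0 subr_ge0 ltW.
- by rewrite divr_ge0 ?mulr_ge0 ?(ltW lam0) ?(ltW NR0) ?(ltW c0).
- by rewrite divr_ge0 ?mulr_ge0 ?(ltW gamma0) ?(ltW NR0) ?(ltW c0).
rewrite ler_pM2r ?invr_gt0 ?mulr_gt0//.
by apply: ler_pM => //; [exact: ltW|rewrite ler_nat].
Qed.

Let half_control t :
  N%:R * (10 * (gamma / N%:R) ^+ 2 * disagreement f PP t t0)
    <= gamma / 2 / 2 * (Rk t - Rk t0) + C.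
Proof.
apply: le_trans (margin_control _ (_ : 0 < gamma / 2) t) _; first exact: divr_gt0.
rewrite lerD2l; apply: le_trans remC.
have nn : N%:R != 0 :> R by rewrite gt_eqF.
have cn : c != 0 by rewrite gt_eqF.
have ln : gamma != 0 by rewrite gt_eqF.
have -> : N%:R * (10 * (gamma / N%:R) ^+ 2) = 10 * gamma ^+ 2 / N%:R by field.
have -> : 10 * gamma ^+ 2 / N%:R / (gamma / 2 / 2 * c) = 40 * gamma / (N%:R * c).
  by field; rewrite ln nn cn.
exact: lexx.
Qed.

(** The term in [m'] lives at scale gamma while only the temperature [4 * beta] can absorb it; this
    mismatch produces [rem]. *)
Let slow_control t :
  N%:R * (10 * (gamma / N%:R) ^+ 2 * disagreement f PP t t0)
    <= 4 * beta / 2 * (Rk t - Rk t0) + rem.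
Proof.
apply: le_trans (margin_control _ (_ : 0 < 4 * beta) t) _; first exact: mulr_gt0.
rewrite lerD2l.
have nn : N%:R != 0 :> R by rewrite gt_eqF.
have cn : c != 0 by rewrite gt_eqF.
have bn : beta != 0 by rewrite gt_eqF.
have -> : N%:R * (10 * (gamma / N%:R) ^+ 2) = 10 * gamma ^+ 2 / N%:R by field.
have -> : 10 * gamma ^+ 2 / N%:R / (4 * beta / 2 * c) =
    20 * gamma ^+ 2 / (N%:R * (4 * beta) * c).
  by field; rewrite bn nn cn.
exact: lexx.
Qed.

Variables (n : nat) (d x0 : R).
Local Notation A := (2 ^+ n.+2 : R).
Local Notation S := (ln (12 / eps) + C).
Local Notation ell := (ln (K%:R ^+ 2 / eps)).
Hypotheses (x00 : 0 < x0) (x0beta : x0 <= beta).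
Hypothesis growth : forall x, x0 <= x ->
  d / 2 <= x * (\int[gibbs pi (fun t => - (x * Rk t))]_t Rk t - Rk t0) <= 2 * d.
Hypothesis nS : 2 * S + 1 <= n%:R * (d / 4).
Hypothesis Abeta : A * (4 * beta) <= gamma.
Hypothesis levelE : log_level eps N beta gamma = - ell.
Hypothesis slope :
  24 * d + 10 * S + rem + 3 / 2 * ell <= gamma / (2 * A * (4 * beta)).

Let eps0 : 0 < eps.
Proof. by have /andP[] := eps01. Qed.

Let K0 : 0 < K%:R :> R.
Proof. by rewrite ltr0n up_log_gt0 N1. Qed.

Let K2eps : 0 < K%:R ^+ 2 / eps.
Proof. by rewrite divr_gt0// exprn_gt0. Qed.

Let ell_ge0 : 0 <= ell.
Proof.
have /andP[_ eps1] := eps01; rewrite ln_ge0// ler_pdivlMr// mul1r (le_trans (ltW eps1))//.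
by rewrite exprn_ege1// ler1n -(ltr0n R).
Qed.

Let tuple_bound (lam : R) : 0 < lam -> lam <= gamma ->
  0 <= lam / N%:R <= 1 / 2 /\ 0 <= lam <= N%:R * (lam / N%:R).
Proof.
move=> lam0 lg; split.
  rewrite divr_ge0 ?(ltW lam0) ?(ltW NR0)//= ler_pdivrMr// (le_trans lg)//.
  by rewrite (le_trans gammaN)// div1r mulrC.
by rewrite (ltW lam0)/= mulrC divfK// gt_eqF.
Qed.

Lemma good_event : exists2 G : set W, measurable G /\ ((1 - eps)%:E <= PP G)%E &
  forall w, G w ->
  (forall j k : nat, (j < k)%N -> (k < K)%N ->
     pair_moment w Rk (2 ^+ j) (2 ^+ k) <= expR ell) /\
  (Bfun f pi eps w (gibbs pi (fun t => - (gamma / 2 * emp_risk R f w t))%R) beta gamma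
    <= 0)%E.
Proof.
have g0 := gamma0; have b0 := beta0; have bg' := bg; have C0' := C0.
have A4 : 4 <= A.
  by rewrite exprS exprS mulrA (_ : 2 * 2 = 4) ?ler_peMr ?exprn_ege1 ?ler1n//; ring.
have aux (v1 v2 v3 v4 v5 v6 M : R) : 0 <= v1 -> 0 <= v2 -> 0 <= v3 -> 0 <= v4 ->
    0 <= v5 -> 0 <= v6 -> v1 + v2 + v3 + v4 + v5 + v6 <= M ->
    [/\ v1 <= M, v2 <= M, v3 <= M, v4 <= M & v5 <= M /\ v6 <= M].
  by move=> *; split; [| | | |split]; lra.
have lerDl_C (p q : R) : 0 <= q -> p <= p + q by move=> *; lra.
have A1 : 1 < A by lra.
have gN : gamma <= N%:R.
  by have gn := gammaN; have nr := NR0; lra.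
have x0b := x0beta.
have x8 : x0 <= 2 * (4 * beta) by lra.
have xg8 : x0 <= gamma / 8 by lra.
have xg4 : x0 <= gamma / 4 by lra.
have x2 : x0 <= 4 * beta / 2 by lra.
have z2 : 0 < 4 * beta by lra.
have z1 : 0 < A * (4 * beta) by apply: mulr_gt0 => //; lra.
have [z3 z4] : 0 < gamma / 4 /\ 0 < gamma / 2 by split; lra.
have [y2 [y3 y4]] : 4 * beta <= gamma /\ gamma / 4 <= gamma /\ gamma / 2 <= gamma.
  by split; [|split]; lra.
have [a1 b1] := tuple_bound z1 Abeta; have [a2 b2] := tuple_bound z2 y2.
have [a3 b3] := tuple_bound z3 y3; have [a4 b4] := tuple_bound z4 y4.
have [ag bg1] := tuple_bound g0 (lexx gamma).
have lc_bound : 0 <= N%:R * ln (cosh (gamma / N%:R)) <= N%:R * (2 * (gamma / N%:R) ^+ 2).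
  rewrite mulr_ge0 ?ln_cosh_ge0 ?(ltW NR0)//= ler_pM2l// ln_cosh_le//.
  by move: ag => /andP[-> h]; rewrite (le_trans h)//; lra.
have lc0 (a : R) : 0 <= (0 : R) <= N%:R * (2 * a ^+ 2).
  by rewrite lexx/= mulr_ge0 ?(ltW NR0)// mulr_ge0// sqr_ge0.
have bhalf : 0 <= gamma / 2 <= N%:R * (gamma / N%:R).
  by rewrite (ltW z4)/= (le_trans y4)//; case/andP: bg1.
have b4g : 0 <= 4 * beta <= N%:R * (gamma / N%:R).
  by rewrite (ltW z2)/= (le_trans y2)//; case/andP: bg1.
(* In order: upper bounds for [Zc] at [A * l2] and [gamma / 4], for [Yc] at [gamma / 2] and [l2],
   then lower bounds for [Zc] at [l2] and [gamma / 2], where [l2 = 4 * beta]. *)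
have [u1 [bu1 u10 u11 U1]] := upper_control prodPP N0 (t0 := t0) a1 b1 (lc0 _) (small_control z1 Abeta).
have [u2 [bu2 u20 u21 U2]] := upper_control prodPP N0 (t0 := t0) a3 b3 (lc0 _) (small_control z3 y3).
have [u3 [bu3 u30 u31 U3]] := upper_control prodPP N0 (t0 := t0) ag bhalf lc_bound half_control.
have [u4 [bu4 u40 u41 U4]] := upper_control prodPP N0 (t0 := t0) ag b4g lc_bound slow_control.
have [u5 [bu5 u50 u51 U5]] := lower_control prodPP N0 a2 b2 (small_control z2 y2) t0_min.
have [u6 [bu6 u60 u61 U6]] := lower_control prodPP N0 a4 b4 (small_control z4 y4) t0_min.
pose pm (k j : nat) (w : W) := pair_moment w Rk (2 ^+ j) (2 ^+ k).
have bpm k j : bmf (pm k j).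
  by apply: (bmf_pair_moment prodPP N0); rewrite exprn_gt0.
pose X1 w := \sum_(k < K) \sum_(j < k) pm k j w.
pose X2 w := u1 w + u2 w + u3 w + u4 w + u5 w + u6 w.
have bX1 : bmf X1 by apply: bmf_sum => k; exact: bmf_sum.
have b12 := bmfD bu1 bu2; have b13 := bmfD b12 bu3.
have b14 := bmfD b13 bu4; have b15 := bmfD b14 bu5.
have bX2 : bmf X2 := bmfD b15 bu6.
have iX1 : \int[PP]_w X1 w <= K%:R ^+ 2 / 2.
  rewrite bmf_int_sum; last by move=> k; exact: bmf_sum.
  apply: le_trans (sum_ord_le K); apply: ler_sum => k _.
  rewrite bmf_int_sum// -[X in _ <= X%:R]card_ord -sumr_const.
  apply: ler_sum => j _; apply: (pair_moment_expectation prodPP N0).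
  by rewrite exprn_gt0.
have iX2 : \int[PP]_w X2 w <= 6.
  rewrite (bmf_intD _ b15 bu6) (bmf_intD _ b14 bu5) (bmf_intD _ b13 bu4).
  rewrite (bmf_intD _ b12 bu3) (bmf_intD _ bu1 bu2).
  have -> : 6 = 1 + 1 + 1 + 1 + 1 + 1 :> R by ring.
  by do !apply: lerD.
(* With these weights the means of [X1] and [X2] contribute at most [eps / 2] each, so one
   application of Markov's inequality covers everything. *)
have bX := bmfD (bmfZ (eps / K%:R ^+ 2) bX1) (bmfZ (eps / 12) bX2).
have X10 w : 0 <= X1 w.
  by apply: sumr_ge0 => k _; apply: sumr_ge0 => j _; exact: pair_moment_ge0.
have X20 w : 0 <= X2 w by rewrite !addr_ge0.
have e1 : 0 < eps / K%:R ^+ 2 by rewrite divr_gt0// exprn_gt0.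
have e2 : 0 < eps / 12 by rewrite divr_gt0.
have iX : \int[PP]_w (eps / K%:R ^+ 2 * X1 w + eps / 12 * X2 w) <= eps.
  rewrite (bmf_intD _ (bmfZ _ bX1) (bmfZ _ bX2)) (bmf_intZ _ _ bX1) (bmf_intZ _ _ bX2).
  rewrite [leRHS](_ : eps = eps / K%:R ^+ 2 * (K%:R ^+ 2 / 2) + eps / 12 * 6); last first.
    by field; rewrite gt_eqF.
  by apply: lerD; rewrite ler_pM2l.
have [|mG PG] := bmf_markov bX _ iX.
  by move=> w; rewrite addr_ge0// mulr_ge0// ltW.
exists [set w | eps / K%:R ^+ 2 * X1 w + eps / 12 * X2 w <= 1] => // w /= Gw.
have X1le : X1 w <= K%:R ^+ 2 / eps.
  have : eps / K%:R ^+ 2 * X1 w <= 1.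
    by apply: le_trans Gw; rewrite lerDl mulr_ge0// ltW.
  by rewrite -ler_pdivlMl// mulr1 invfM invrK mulrC.
have X2le : X2 w <= 12 / eps.
  have : eps / 12 * X2 w <= 1.
    by apply: le_trans Gw; rewrite lerDr mulr_ge0// ltW.
  by rewrite -ler_pdivlMl// mulr1 invfM invrK mulrC.
split.
  move=> j k jk kK; rewrite lnK ?posrE//; apply: le_trans X1le.
  rewrite /X1 (bigD1 (Ordinal kK))//= (bigD1 (Ordinal jk))//= -addrA lerDl.
  apply: addr_ge0; last first.
    by apply: sumr_ge0 => k' _; apply: sumr_ge0 => j' _; exact: pair_moment_ge0.
  by apply: sumr_ge0 => j' _; exact: pair_moment_ge0.
have [v1 v2 v3 v4 [v5 v6]] := aux _ _ _ _ _ _ _ (u10 w) (u20 w) (u30 w) (u40 w)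
  (u50 w) (u60 w) X2le.
have M0 : 0 < 12 / eps by rewrite divr_gt0.
have drop (a : R) : partition pi (fun t =>
      - (a * (emp_risk R f w t - emp_risk R f w t0)) + 0 * emp_dist R f w t t0) =
    partition pi (fun t => - (a * (emp_risk R f w t - emp_risk R f w t0))).
  by apply: eq_Rintegral => t _; rewrite mul0r addr0.
have dyad m x (hx : x0 <= x) := andP (dyadic_growth bRk x00 growth m hx).
have h8 : gamma / 4 / 2 = gamma / 8 by field.
have h4 : gamma / 2 / 2 = gamma / 4 by field.
have h2 : 2 * (gamma / 2) = gamma by field.
have V1 := U1 w _ M0 v1; have V2 := U2 w _ M0 v2; have V3 := U3 w _ M0 v3.
have V4 := U4 w _ M0 v4; have V5 := U5 w _ M0 v5; have V6 := U6 w _ M0 v6.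
rewrite drop in V1; rewrite drop h8 in V2; rewrite h4 in V3; rewrite h2 in V6.
(* [A] is [2 ^+ n.+2] so that [n] doublings lead from [2 * l2] to [A * l2 / 2]; by [nS] they lower
   the log partition function by at least [2 * S + 1]. *)
have E1 : 2 ^+ n * (2 * (4 * beta)) = A * (4 * beta) / 2.
  by rewrite exprS exprS; field.
have E2 : 2 ^+ 3 * (gamma / 8) = gamma by field.
have E3 : 2 ^+ 2 * (gamma / 4) = gamma by field.
have E4 : 2 ^+ 2 * (4 * beta / 2) = 2 * (4 * beta) by field.
have [D1 _] := dyad n _ x8; have [_ D2] := dyad 3%N _ xg8.
have [_ D3] := dyad 2%N _ xg4; have [_ D4] := dyad 2%N _ x2.
rewrite E1 in D1; rewrite E2 in D2; rewrite E3 in D3; rewrite E4 in D4.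
have d6 : 3%:R * (2 * d) = 6 * d by ring.
have d4 : 2%:R * (2 * d) = 4 * d by ring.
rewrite d6 in D2; rewrite d4 in D3; rewrite d4 in D4.
(* [V4] has [rem] in place of [C]; adding [C] brings it to the common constant [S]. *)
have V4' := le_trans V4 (lerD (lerD (lerDl_C _ _ C0') (lexx rem)) (lexx _)).
apply: (Bfun_le0_sufficient N0 beta0 gamma0 (A := A) A1 gN _
  V1 V2 V3 V4' V5 V6 (le_trans nS D1) D2 D3 D4); rewrite levelE opprK.
- exact: ell_ge0.
- exact: slope.
Qed.

End good_event.

End learning.

(** * From the good event to the risk of the selected posterior *)

Theorem corollary2p1p17 (R : realType) :
  exists B7 B8 : R, 0 < B7 /\ 0 < B8 /\
  forall (dX : measure_display) (X : measurableType dX)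
    (dY : measure_display) (Y : measurableType dY)
    (dT : measure_display) (Theta : measurableType dT)
    (f : Theta -> X -> Y) (pi : probability Theta R)
    (P : forall N : nat, 'I_N -> probability (X * Y)%type R)
    (PP : forall N : nat, probability (N.-tuple (X * Y)%type) R)
    (eps : R) (Risk : Theta -> R) (t0 : Theta) (c kappa d : R),
    finite_set [set: Y] ->
    (forall A : set Y, measurable A) ->
    measurable_fun [set: Theta * X] (fun z => f z.1 z.2) ->
    (forall N : nat, is_product_measure (PP N) (P N)) ->
    0 < eps < 1 ->
    (forall N : nat, (0 < N)%N -> forall t, risk f (PP N) t = Risk t) ->
    Risk t0 = inf (range Risk) ->
    0 < c -> 1 < kappa ->
    (forall N : nat, (0 < N)%N -> forall t,
       c * disagreement f (PP N) t t0 `^ kappa <= Risk t - Risk t0) ->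
    0 < d ->
    b * ((\int[gibbs pi (fun t => - (b * Risk t))]_t Risk t)
         - inf (range Risk)) @[b --> +oo] --> d ->
  exists N1 : nat, forall N : nat, (N1 <= N)%N ->
  forall gamma_hat : N.-tuple (X * Y)%type -> R,
    (forall w, is_gamma_hat f pi eps w (gamma_hat w)) ->
  exists2 A : set (N.-tuple (X * Y)%type),
    measurable A /\ ((1 - eps)%:E <= PP N A)%E &
    forall w, A w ->
      \int[gibbs pi (fun t => - (gamma_hat w * (emp_risk R f w t / 2)))]_t
         Risk t
      <= inf (range Risk)
         + B7 * c `^ (- (2 * kappa - 1)^-1)
           * (1 + B8 / d * ln (ln N%:R / eps)) `^ (2 * kappa / (2 * kappa - 1))
           * (d / N%:R) `^ (kappa / (2 * kappa - 1)).
Proof.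
exists 1, 1; split=> //; split=> //.
(* Here [q] is the grid value known to be admissible and [q'] the selected one; losing a factor 2
   between them turns [2 * D / q'] into [4 * D / q]. *)
have excess D (q q' v r p : R) : 0 < D -> 0 < q -> q / 2 < q' ->
    q' * (v - r) <= 2 * D -> 4 * D / q <= p -> v <= r + p.
  move=> D0 q0 qq' h hp; rewrite -lerBlDl; apply: le_trans hp.
  rewrite ler_pdivlMr//; have [vr|vr] := leP (v - r) 0; nra.
move=> dX X dY Y dT Theta f pi P PP eps Risk t0 c kappa d finY mY mf prodPP eps01
  RiskE Risk0 c0 kappa1 margin d0 lim.
have eps0 : 0 < eps by case/andP: eps01.
have RE N : (0 < N)%N -> risk f (PP N) = Risk by move=> ?; apply/funext => t; exact: RiskE.
have bR : bmf Risk by rewrite -(RE 1%N)//; exact: (bmf_risk pi finY mY mf (prodPP 1%N)).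
have R01 t : 0 <= Risk t <= 1 by rewrite -(RE 1%N)//; exact: (risk_itv finY mY mf (prodPP 1%N)).
have Rmin t : Risk t0 <= Risk t.
  rewrite Risk0; apply: ge_inf; last by exists t.
  by exists 0 => _ [s _ <-]; case/andP: (R01 s).
have [x0 [x00 growth]] : exists x0 : R, 0 < x0 /\ forall x, x0 <= x ->
    d / 2 <= x * (\int[gibbs pi (fun t => - (x * Risk t))]_t Risk t - Risk t0) <= 2 * d.
  have aux (v : R) : `|d - v| < d / 2 -> d / 2 <= v <= 2 * d.
    by rewrite ltr_norml => /andP[h1 h2]; apply/andP; split; lra.
  have d20 : 0 < d / 2 by exact: divr_gt0.
  have /cvgrPdist_lt/(_ _ d20) [M [_ Mlim]] := lim.
  exists (`|M| + 1); split; first by rewrite ltr_wpDl.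
  move=> x Mx; apply: aux; rewrite Risk0; apply: Mlim.
  by apply: le_lt_trans (ler_norm _) _; apply: lt_le_trans Mx; rewrite ltrDl.
pose C := 10 * (40 / c) `^ (kappa - 1)^-1.
pose S := ln (12 / eps) + C.
have C0 : 0 <= C by rewrite mulr_ge0 ?powR_ge0.
have S0 : 0 <= S.
  rewrite addr_ge0// ln_ge0// ler_pdivlMr// mul1r.
  by case/andP: eps01 => _ /ltW /le_trans; apply; rewrite ler1n.
have [n nS] : exists n : nat, 2 * S + 1 <= n%:R * (d / 4).
  exists (Num.truncn ((2 * S + 1) / (d / 4))).+1.
  by rewrite -ler_pdivrMr ?divr_gt0// ltW// truncnS_gt.
have A1 : 1 <= 2 ^+ n.+2 :> R by rewrite exprn_ege1// ler1n.
(* The threshold is [2 * x0] because the selected beta is only known to exceed half of [2 ^+ j]. *)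
have [N1 N1P] := rate_parameters kappa1 c0 d0 eps01 A1 S0
  (mulr_gt0 (ltr0Sn R 1) x00).
exists N1 => N NN gamma_hat gamma_hatP.
have [j [k [[N2 gN Ab xb] [remC slope rate]]]] := N1P N NN.
have Nn : (0 < N)%N by exact: ltnW.
have REN := RE N Nn.
have NR0 : 0 < N%:R :> R by rewrite ltr0n.
have b0 : 0 < 2 ^+ j :> R by rewrite exprn_gt0.
have g0 : 0 < 2 ^+ k :> R by rewrite exprn_gt0.
have A4 : 4 <= 2 ^+ n.+2 :> R.
  by rewrite exprS exprS mulrA (_ : 2 * 2 = 4) ?ler_peMr ?exprn_ege1 ?ler1n//; ring.
have bg : 16 * 2 ^+ j <= 2 ^+ k :> R.
  have h : 4 * (4 * 2 ^+ j) <= 2 ^+ n.+2 * (4 * 2 ^+ j) :> R by rewrite ler_pM2r// mulr_gt0.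
  by apply: le_trans Ab; apply: le_trans h; rewrite mulrA -natrM.
have jk : (j < k)%N.
  rewrite -(@ltr_eXn2l R 2) ?ltr1n//; apply: lt_le_trans bg.
  by rewrite ltr_pMl// ltr1n.
have kK : (k < up_log 2 N)%N.
  rewrite ltnNge; apply/negP => /(leq_pexp2l (isT : 0 < 2)%N) h.
  have : N%:R <= 2 ^+ k :> R.
    by rewrite -natrX ler_nat (leq_trans _ h)// up_logP.
  by move/le_trans/(_ gN); rewrite leNgt ltr_pdivrMr// ltr_pMr// ltr1n.
have jK : (j < up_log 2 N)%N by exact: ltn_trans kK.
have x0j : x0 <= 2 ^+ j by rewrite (le_trans _ xb)// ler_peMl ?ler1n// ltW.
have margin' t : c * disagreement f (PP N) t t0 `^ kappa <=
    risk f (PP N) t - risk f (PP N) t0 by rewrite !RiskE//; exact: margin.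
have Rmin' t : risk f (PP N) t0 <= risk f (PP N) t by rewrite !RiskE.
have growth' x : x0 <= x -> d / 2 <= x *
    (\int[gibbs pi (fun t => - (x * risk f (PP N) t))]_t risk f (PP N) t
      - risk f (PP N) t0) <= 2 * d by rewrite REN; exact: growth.
have [A [mA PA] good] := good_event finY mY mf (prodPP N) N2 eps01 c0 kappa1 Rmin' margin'
  b0 bg gN remC x00 x0j growth' nS Ab (log_levelE eps0 N2 jK kK) slope.
exists A => // w Aw; have [pm B0] := good w Aw; rewrite REN in pm.
have halfE (g : R) : (fun t => - (g * (emp_risk R f w t / 2))) =
    (fun t => - (g / 2 * emp_risk R f w t)).
  by apply/funext => t; rewrite mulrCA mulrC.
have Lam i : (i < up_log 2 N)%N -> Lambda2 N (2 ^+ i : R).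
  by move=> iK; rewrite Lambda2E//; exists i.
have [Lg gmax] := gamma_hatP w.
(* A value strictly below the supremum yields an actual admissible beta above it, with no need to
   show that the maximum is attained. *)
have : ((2 ^+ j / 2)%:E < beta_max f pi eps w (gamma_hat w))%E.
  apply: lt_le_trans (gmax _ (Lam k kK)).
  apply: (@lt_le_trans _ _ (2 ^+ j)%:E); first by rewrite lte_fin ltr_pdivrMr// ltr_pMr// ltr1n.
  apply: ereal_sup_ubound; exists (2 ^+ j); last by reflexivity.
  split; first exact: (Lam j jK).
  by rewrite halfE; exact: B0.
case/ereal_sup_gt => _ [bh [Lb Bb] <-]; rewrite lte_fin => bh_gt.
move: Lg Lb; rewrite Lambda2E// => -[k' k'K gE] [j' j'K bE].
rewrite halfE -gE -bE in Bb *; rewrite -bE in bh_gt.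
have bh0 : 0 < 2 ^+ j' :> R by rewrite exprn_gt0.
have gh0 : 0 < 2 ^+ k' :> R by rewrite exprn_gt0.
have ell0 : 0 < - log_level eps N (2 ^+ j' : R) (2 ^+ k').
  rewrite (log_levelE eps0 N2 j'K k'K) opprK ln_gt0// ltr_pdivlMr// mul1r.
  case/andP: eps01 => _ /lt_le_trans; apply.
  by rewrite exprn_ege1// ler1n up_log_gt0 N2.
have jk' : (j' < k')%N.
  (* The selected pair satisfies [j' < k'], so it is among the pairs covered by the good event. *)
  by rewrite -(@ltr_eXn2l R 2) ?ltr1n//; exact: (Bfun_le0_lt finY mY mf Nn bh0 gh0 ell0 Bb).
have := pm j' k' jk' k'K.
rewrite -[ln _]opprK -(log_levelE eps0 N2 j'K k'K).
move=> /(Bfun_le0_risk finY mY mf Nn bR R01 bh0 gh0 ell0 Bb) rhoR.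
have x0j' : x0 <= 2 ^+ j'.
  by apply: le_trans (ltW bh_gt); rewrite ler_pdivlMr// mulrC.
have /andP[_ gr] := growth _ x0j'.
rewrite mul1r div1r -Risk0.
apply: le_trans rhoR _.
apply: (excess d _ _ _ _ _ d0 b0 bh_gt gr rate).
Qed.
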